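(* Let $A\in\mathcal{H}(d)$ be a $d\times d$ complex Hermitian matrix and let $X,Y$ be $d\times k$ complex isometries ($X^*X=Y^*Y=I_k$) with ranges $\mathcal{X}=R(X)$, $\mathcal{Y}=R(Y)$, $\dim\mathcal{X}=\dim\mathcal{Y}=k$, and let $\Theta=\Theta(\mathcal{X},\mathcal{Y})$. Then: (1) $|\lambda(X^*AX)-\lambda(Y^*AY)|\prec_w \Theta\,\mathrm{Spr}^+(A)$; (2) if moreover $\mathcal{X}$ is $A$-invariant, then $|\lambda(X^*AX)-\lambda(Y^*AY)|\prec_w \Theta^2\,\mathrm{Spr}^+(A)$. Here absolute values, squares and products are entrywise, and submajorization/products between vectors of possibly different lengths are interpreted by padding with zeros on the right.
   Context: For Hermitian $M$, $\lambda(M)$ denotes the vector of eigenvalues counting multiplicities arranged non-increasingly; $s(Z)$ denotes singular values arranged non-increasingly. For $x,y\in\mathbb{R}^k$, $x\prec_w y$ means $\sum_{i=1}^r x_i^\downarrow\le\sum_{i=1}^r y_i^\downarrow$ for all $r$, where $x^\downarrow$ is the non-increasing rearrangement; for non-negative vectors of different lengths, pad the shorter with zeros. Spectral spread: $h=\lfloor d/2\rfloor$, $\mathrm{Spr}^+(A)=(\lambda_j(A)-\lambda_{d-j+1}(A))_{j=1}^h$. Principal angles: $\Theta(\mathcal{X},\mathcal{Y})=(\theta_j)_{j=1}^k\in[0,\pi/2]^k$ with $\cos\theta_j=s_{k-j+1}(X^*Y)$ (so $\theta_1\ge\dots\ge\theta_k$). *)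

(* Defs.v *)
From HB Require Import structures.
From mathcomp Require Import all_boot all_order all_algebra.
From mathcomp Require Import complex sesquilinear spectral.
From mathcomp Require Import reals trigo.

Set Implicit Arguments.
Unset Strict Implicit.
Unset Printing Implicit Defensive.

Import Order.TTheory GRing.Theory Num.Theory.
Local Open Scope ring_scope.
Local Open Scope sesquilinear_scope.

Section Defs.
Variable R : realType.
Local Notation C := R[i].

Definition adjmx m n (M : 'M[C]_(m, n)) : 'M[C]_(n, m) := M ^t*.

Definition is_isometry d k (X : 'M[C]_(d, k)) : Prop := adjmx X *m X = 1%:M.

Definition is_hermitian d (A : 'M[C]_d) : Prop := A \is hermsymmx.

Definition sort_dec (s : seq R) : seq R := sort (fun x y => y <= x) s.

(* lambda(M): eigenvalues of (Hermitian) M counted with multiplicity,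
   arranged non-increasingly.  For Hermitian M, M = P^-1 diag(D) P with P
   unitary (spectral theorem, orthomx_spectralP) and D real
   (hermitian_spectral_diag_real), so the real parts are the eigenvalues. *)
Definition eigvals n (M : 'M[C]_n) : seq R :=
  sort_dec [seq complex.Re (spectral_diag M 0 i) | i <- enum 'I_n].

Definition svals k (Z : 'M[C]_k) : seq R :=
  [seq Num.sqrt x | x <- eigvals (adjmx Z *m Z)].

(* Theta(R(X), R(Y)) = (theta_j)_{j=1..k}, cos theta_j = s_{k-j+1}(X^* Y),
   theta_j in [0, pi/2]; hence theta_1 >= ... >= theta_k. *)
Definition angles d k (X Y : 'M[C]_(d, k)) : seq R :=
  rev [seq acos s | s <- svals (adjmx X *m Y)].

Definition spr_plus d (A : 'M[C]_d) : seq R :=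
  let l := eigvals A in
  [seq nth 0 l j - nth 0 l (d - j.+1)%N | j <- iota 0 d./2].

(* X A-invariant:  A R(X) <= R(X)  (column spaces), i.e. the row space of
   X^T is stable under right multiplication by A^T. *)
Definition A_invariant d k (A : 'M[C]_d) (X : 'M[C]_(d, k)) : bool :=
  stablemx X^T A^T.

Definition pad (n : nat) (s : seq R) : seq R := s ++ nseq (n - size s) 0.

Definition absdiff (x y : seq R) : seq R :=
  [seq `|p.1 - p.2| | p <- zip x y].

Definition sqv (x : seq R) : seq R := [seq t ^+ 2 | t <- x].

Definition mulv (x y : seq R) : seq R :=
  let n := maxn (size x) (size y) in
  [seq p.1 * p.2 | p <- zip (pad n x) (pad n y)].

Definition wmaj (x y : seq R) : Prop :=
  let n := maxn (size x) (size y) in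
  forall r : nat, (r <= n)%N ->
    \sum_(a <- take r (sort_dec (pad n x))) a
      <= \sum_(a <- take r (sort_dec (pad n y))) a.

End Defs.

(* Main.v *)
(* Move from X to Y along the direct rotation: with principal vectors X', Y' and
   Y' = X' cos(Theta) + Z sin(Theta), put X_t = X' cos(t Theta) + Z sin(t Theta)
   and Z_t = Z cos(t Theta) - X' sin(t Theta).  By Lidskii's inequality, a sum of
   r terms |lambda_i(X^*AX) - lambda_i(Y^*AY)| is at most f(1) - f(0), where
   f(t) = Re tr(W X_t^*AX_t) for some Hermitian contraction W of trace norm r.
   Here
     f'(t) = 2 Re tr(W X_t^*AZ_t Theta),
     f''(t) = 2 Re tr(W (Theta Z_t^*AZ_t - X_t^*AX_t Theta) Theta),
   and f'(0) = 0 when the range of X is A-invariant, so the mean value theorem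
   reduces both claims to bounding f' and f''/2 by the sum over j < r of
   theta_j Spr_j(A), respectively theta_j^2 Spr_j(A).  These expressions are linear
   in A and vanish at the identity; summation by parts over the spectrum of A
   reduces to the case of a projection A = P of rank m, and summation by parts
   over the angles reduces to Theta replaced by coordinate projections of rank n.
   Then the trace is at most each of m, n and r, because all the matrices
   involved are contractions. *)
From HB Require Import structures.
Require Import Defs.
From mathcomp Require Import all_boot all_order all_algebra.
From mathcomp Require Import fingroup perm complex sesquilinear spectral.
From mathcomp Require Import reals trigo.
From mathcomp Require Import ring lra zify.
Set Implicit Arguments.
Unset Strict Implicit.
Unset Printing Implicit Defensive.
Import Order.TTheory GRing.Theory Num.Theory.
Local Open Scope ring_scope.
Local Open Scope sesquilinear_scope.

(* An abstract copy of [R] inside [R[i]]: with [C] a variable, unification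
   never unfolds the arithmetic of [R[i]]. *)
Record real_part (R : realType) (C : numClosedFieldType) := RealPart {
  re : C -> R;
  emb : {rmorphism R -> C};
  reD : forall x y, re (x + y) = re x + re y;
  re_embM : forall a x, re (emb a * x) = a * re x;
  re1 : re 1 = 1;
  re_conj : forall x, re (Num.conj x) = re x;
  conj_emb : forall a, Num.conj (emb a) = emb a;
  re_sqr_ge0 : forall x, 0 <= re (Num.conj x * x);
  re_sqr_eq0 : forall x, re (Num.conj x * x) = 0 -> x = 0;
  emb_re : forall x, x \is Num.real -> emb (re x) = x }.

(** * Conjugate transpose *)

Definition ctr (C : numClosedFieldType) m n (M : 'M[C]_(m, n)) : 'M[C]_(n, m) :=
  M ^t*.

Local Notation "A ^h" := (ctr A) (at level 8, format "A ^h").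

Section ConjugateTranspose.
Variable C : numClosedFieldType.

Lemma ctrE m n (A : 'M[C]_(m, n)) i j : A^h i j = Num.conj (A j i).
Proof. by rewrite /ctr !mxE. Qed.

Lemma ctrK m n (A : 'M[C]_(m, n)) : A^h^h = A.
Proof. exact: trmxCK. Qed.

Lemma ctrM m n p (A : 'M[C]_(m, n)) (B : 'M[C]_(n, p)) :
  (A *m B)^h = B^h *m A^h.
Proof. by rewrite /ctr trmx_mul map_mxM. Qed.

Lemma ctrD m n (A B : 'M[C]_(m, n)) : (A + B)^h = A^h + B^h.
Proof. by apply/matrixP=> i j; rewrite !mxE rmorphD. Qed.

Lemma ctrN m n (A : 'M[C]_(m, n)) : (- A)^h = - A^h.
Proof. by apply/matrixP=> i j; rewrite !mxE rmorphN. Qed.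

Lemma ctrB m n (A B : 'M[C]_(m, n)) : (A - B)^h = A^h - B^h.
Proof. by rewrite ctrD ctrN. Qed.

Lemma ctr1 n : (1%:M : 'M[C]_n)^h = 1%:M.
Proof. by rewrite /ctr trmx1 map_mx1. Qed.

Lemma ctr0 m n : (0 : 'M[C]_(m, n))^h = 0.
Proof. by rewrite /ctr trmx0 map_mx0. Qed.

End ConjugateTranspose.

(** * Real traces, the real Frobenius inner product, contractions, real diagonal matrices *)

Section RealInnerProduct.
Variables (R : realType) (C : numClosedFieldType) (K : real_part R C).
Local Notation re := (re K).
Local Notation emb := (emb K).

Lemma reN (x : C) : re (- x) = - re x.
Proof. by rewrite -mulN1r -(rmorphN1 emb) re_embM mulN1r. Qed.

Lemma re0 : re 0 = 0.
Proof. by rewrite -(mul0r 0) -(rmorph0 emb) re_embM mul0r. Qed.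

Lemma re_sum I (r : seq I) (P : pred I) (F : I -> C) :
  re (\sum_(i <- r | P i) F i) = \sum_(i <- r | P i) re (F i).
Proof. exact: (big_morph _ (reD K) re0). Qed.

Lemma re_emb a : re (emb a) = a.
Proof. by rewrite -[emb a]mulr1 re_embM re1 mulr1. Qed.

Definition rtr n (M : 'M[C]_n) : R := re (\tr M).

Lemma rtrD n (A B : 'M[C]_n) : rtr (A + B) = rtr A + rtr B.
Proof. by rewrite /rtr mxtraceD reD. Qed.

Lemma rtrN n (A : 'M[C]_n) : rtr (- A) = - rtr A.
Proof. by rewrite /rtr raddfN reN. Qed.

Lemma rtrB n (A B : 'M[C]_n) : rtr (A - B) = rtr A - rtr B.
Proof. by rewrite rtrD rtrN. Qed.

Lemma rtr0 n : rtr (0 : 'M[C]_n) = 0.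
Proof. by rewrite /rtr mxtrace0 re0. Qed.

Lemma rtr_sum n I (r : seq I) (P : pred I) (F : I -> 'M[C]_n) :
  rtr (\sum_(i <- r | P i) F i) = \sum_(i <- r | P i) rtr (F i).
Proof. by apply: (big_morph _ (@rtrD n)); rewrite rtr0. Qed.

Lemma rtrZ n (a : R) (A : 'M[C]_n) : rtr (emb a *: A) = a * rtr A.
Proof. by rewrite /rtr mxtraceZ re_embM. Qed.

Lemma rtr_mulC m n (A : 'M[C]_(m, n)) (B : 'M[C]_(n, m)) :
  rtr (A *m B) = rtr (B *m A).
Proof. by rewrite /rtr mxtrace_mulC. Qed.

Lemma rtr_ctr n (A : 'M[C]_n) : rtr A^h = rtr A.
Proof.
rewrite /rtr /mxtrace !re_sum; apply: eq_bigr => i _.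
by rewrite ctrE re_conj.
Qed.

Definition ip m n (A B : 'M[C]_(m, n)) : R := rtr (A^h *m B).

Lemma ipE m n (A B : 'M[C]_(m, n)) : ip A B = rtr (A^h *m B).
Proof. by []. Qed.

Lemma ipC m n (A B : 'M[C]_(m, n)) : ip A B = ip B A.
Proof. by rewrite /ip -rtr_ctr ctrM ctrK. Qed.

Lemma ipDr m n (A B D : 'M[C]_(m, n)) : ip A (B + D) = ip A B + ip A D.
Proof. by rewrite /ip mulmxDr rtrD. Qed.

Lemma ipDl m n (A B D : 'M[C]_(m, n)) : ip (A + B) D = ip A D + ip B D.
Proof. by rewrite ipC ipDr !(ipC D). Qed.

Lemma ipNr m n (A B : 'M[C]_(m, n)) : ip A (- B) = - ip A B.
Proof. by rewrite /ip mulmxN rtrN. Qed.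

Lemma ipNl m n (A B : 'M[C]_(m, n)) : ip (- A) B = - ip A B.
Proof. by rewrite ipC ipNr ipC. Qed.

Lemma ip_mull m n p (G : 'M[C]_(m, n)) (A : 'M[C]_(n, p)) B :
  ip (G *m A) B = ip A (G^h *m B).
Proof. by rewrite /ip ctrM mulmxA. Qed.

Lemma ip_ge0 m n (A : 'M[C]_(m, n)) : 0 <= ip A A.
Proof.
rewrite /ip /rtr /mxtrace re_sum sumr_ge0 // => i _.
rewrite mxE re_sum sumr_ge0 // => j _.
by rewrite ctrE re_sqr_ge0.
Qed.

Lemma ip_eq0 m n (A : 'M[C]_(m, n)) : ip A A = 0 -> A = 0.
Proof.
have -> : ip A A = \sum_i \sum_j re (Num.conj (A j i) * A j i).
  rewrite /ip /rtr /mxtrace re_sum; apply: eq_bigr => i _.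
  by rewrite mxE re_sum; apply: eq_bigr => j _; rewrite ctrE.
move=> /eqP; rewrite psumr_eq0; last first.
  by move=> i _; apply: sumr_ge0 => j _; apply: re_sqr_ge0.
move=> /allP hA; apply/matrixP => j i; rewrite mxE.
have /implyP/(_ isT) := hA i (mem_index_enum _).
rewrite psumr_eq0; last by move=> ? _; apply: re_sqr_ge0.
move=> /allP/(_ j (mem_index_enum _))/implyP/(_ isT)/eqP.
exact: re_sqr_eq0.
Qed.

Lemma ip_sqrD m n (A B : 'M[C]_(m, n)) :
  ip (A + B) (A + B) = ip A A + 2 * ip A B + ip B B.
Proof. by rewrite !(ipDl, ipDr) (ipC B A); ring. Qed.

(** Positivity of the square of [A - B]; this stands in for Cauchy-Schwarz throughout. *)
Lemma ip_le m n (A B : 'M[C]_(m, n)) : 2 * ip A B <= ip A A + ip B B.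
Proof.
have := ip_ge0 (A - B).
by rewrite ip_sqrD ipNr ipNl ipNr; lra.
Qed.

(** Operator norm at most one. Testing on [x] of every width lets the bound apply directly to blocks
    such as [Z^h *m P]. *)
Definition contractive m n (G : 'M[C]_(m, n)) : Prop :=
  forall p (x : 'M[C]_(n, p)), ip (G *m x) (G *m x) <= ip x x.

Lemma contractiveP m n (G : 'M[C]_(m, n)) :
  contractive G <->
  forall p (x : 'M[C]_(n, p)), ip (G *m x) (G *m x) <= ip x x.
Proof. by []. Qed.

Lemma contractiveM m n p (G : 'M[C]_(m, n)) (H : 'M[C]_(n, p)) :
  contractive G -> contractive H -> contractive (G *m H).
Proof.
move=> hG hH q x; rewrite -mulmxA; exact: le_trans (hG _ _) (hH _ _).
Qed.

Lemma contractiveN m n (G : 'M[C]_(m, n)) : contractive G -> contractive (- G).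
Proof. by move=> hG p x; rewrite mulNmx ipNr ipNl opprK; apply: hG. Qed.

(** The squared norm of [G^h *m x] is [ip x (G *m (G^h *m x))]; by [ip_le] and contractivity of [G]
    it is at most half of [ip x x] plus half of itself. *)
Lemma contractive_ctr m n (G : 'M[C]_(m, n)) :
  contractive G -> contractive G^h.
Proof.
move=> hG p x; have h1 := ip_le x (G *m (G^h *m x)).
have h2 := hG _ (G^h *m x).
have h3 : ip x (G *m (G^h *m x)) = ip (G^h *m x) (G^h *m x).
  by rewrite [in RHS]ip_mull ctrK.
lra.
Qed.

Lemma contractive_ip m n p (G : 'M[C]_(m, n)) (x : 'M[C]_(n, p)) y :
  contractive G -> 2 * ip y (G *m x) <= ip y y + ip x x.
Proof. by move=> /(_ _ x) h; have := ip_le y (G *m x); lra. Qed.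

Lemma isometry_contractive m n (G : 'M[C]_(m, n)) :
  G^h *m G = 1%:M -> contractive G.
Proof. by move=> hG p x; rewrite ip_mull mulmxA hG mul1mx. Qed.

Definition rdiag n (a : 'I_n -> R) : 'M[C]_n := diag_mx (\row_i emb (a i)).

Lemma rdiagE n (a : 'I_n -> R) i j : rdiag a i j = emb (a i) *+ (i == j).
Proof. by rewrite !mxE. Qed.

Lemma eq_rdiag n (a b : 'I_n -> R) : a =1 b -> rdiag a = rdiag b.
Proof. by move=> e; apply/matrixP=> i j; rewrite !rdiagE e. Qed.

Lemma rdiagM n (a b : 'I_n -> R) :
  rdiag a *m rdiag b = rdiag (fun i => a i * b i).
Proof.
rewrite /rdiag mulmx_diag; congr diag_mx.
by apply/rowP => i; rewrite !mxE rmorphM.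
Qed.

Lemma rdiagC n (a b : 'I_n -> R) : rdiag a *m rdiag b = rdiag b *m rdiag a.
Proof. by rewrite !rdiagM; apply: eq_rdiag => i; rewrite mulrC. Qed.

Lemma rdiagD n (a b : 'I_n -> R) :
  rdiag a + rdiag b = rdiag (fun i => a i + b i).
Proof. by apply/matrixP=> i j; rewrite !mxE rmorphD -mulrnDl. Qed.

Lemma rdiagN n (a : 'I_n -> R) : - rdiag a = rdiag (fun i => - a i).
Proof. by apply/matrixP=> i j; rewrite !mxE rmorphN -mulNrn. Qed.

Lemma rdiag1 n : rdiag (fun _ : 'I_n => 1) = 1%:M.
Proof. by apply/matrixP=> i j; rewrite !mxE rmorph1. Qed.

Lemma rdiag0 n : rdiag (fun _ : 'I_n => 0) = 0.
Proof. by apply/matrixP=> i j; rewrite !mxE rmorph0 mul0rn. Qed.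

Lemma rdiag_cst n (x : R) : rdiag (fun _ : 'I_n => x) = (emb x)%:M.
Proof. by apply/matrixP=> i j; rewrite !mxE. Qed.

Lemma ctr_rdiag n (a : 'I_n -> R) : (rdiag a)^h = rdiag a.
Proof.
apply/matrixP=> i j; rewrite ctrE !rdiagE eq_sym.
by case: eqP => [->|_]; rewrite ?mulr1n ?conj_emb // mulr0n rmorph0.
Qed.

Lemma rtr_rdiag n (a : 'I_n -> R) : rtr (rdiag a) = \sum_i a i.
Proof.
by rewrite /rtr /mxtrace re_sum; apply: eq_bigr => i _; rewrite rdiagE eqxx re_emb.
Qed.

Lemma mul_rdiagE n m (a : 'I_n -> R) (M : 'M[C]_(n, m)) i j :
  (rdiag a *m M) i j = emb (a i) * M i j.
Proof. by rewrite mul_diag_mx !mxE. Qed.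

Lemma mul_mx_rdiagE n m (a : 'I_n -> R) (M : 'M[C]_(m, n)) i j :
  (M *m rdiag a) i j = emb (a j) * M i j.
Proof. by rewrite mul_mx_diag !mxE mulrC. Qed.

Lemma rtr_mul_rdiag n (a : 'I_n -> R) (M : 'M[C]_n) :
  rtr (rdiag a *m M) = \sum_i a i * re (M i i).
Proof.
rewrite /rtr /mxtrace re_sum; apply: eq_bigr => i _.
by rewrite mul_rdiagE re_embM.
Qed.

Lemma ip_rdiag n m (a : 'I_n -> R) (x : 'M[C]_(n, m)) :
  ip x (rdiag a *m x) = \sum_i a i * ip (row i x) (row i x).
Proof.
rewrite /ip rtr_mulC -mulmxA rtr_mul_rdiag; apply: eq_bigr => i _; congr (_ * _).
rewrite rtr_mulC /rtr /mxtrace big_ord1 -[x^h](ctrK).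
rewrite !mxE; congr re; apply: eq_bigr => j _.
by rewrite !mxE /= conjCK.
Qed.

Lemma le_ip_rdiag n m (a b : 'I_n -> R) (x : 'M[C]_(n, m)) :
  (forall i, a i <= b i) -> ip x (rdiag a *m x) <= ip x (rdiag b *m x).
Proof.
move=> ab; rewrite !ip_rdiag; apply: ler_sum => i _.
by rewrite ler_wpM2r // ip_ge0.
Qed.

Lemma contractive_rdiag n (a : 'I_n -> R) :
  (forall i, a i ^+ 2 <= 1) -> contractive (rdiag a).
Proof.
move=> ha p x; rewrite ip_mull ctr_rdiag mulmxA rdiagM.
rewrite -[leRHS](_ : ip x (rdiag (fun=> 1) *m x) = _); last first.
  by rewrite rdiag1 mul1mx.
by apply: le_ip_rdiag => i; rewrite -expr2.
Qed.

End RealInnerProduct.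

(** * Summation by parts and folding of finite sums *)

Section Abel.
Variable R : realFieldType.

Lemma noninc_le n (a : nat -> R) : (forall i, (i.+1 < n)%N -> a i.+1 <= a i) ->
  forall i j, (i <= j)%N -> (j < n)%N -> a j <= a i.
Proof.
move=> aS i; elim=> [|j IH] ij jd; first by have -> : i = 0%N by lia.
have [->//|ne] := eqVneq i j.+1.
by apply: le_trans (aS _ jd) (IH _ _); lia.
Qed.

(** The partial sums carry indicator weights over a fixed range, the form in which traces against
    coordinate projections produce them. *)
Lemma abel_sum_ge0 k (a : nat -> R) (z : 'I_k -> R) :
  (forall i, (i.+1 < k)%N -> a i.+1 <= a i) ->
  (forall i, (i < k)%N -> 0 <= a i) ->
  (forall n, (n <= k)%N -> 0 <= \sum_(i < k) (i < n)%:R * z i) ->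
  0 <= \sum_(i < k) a i * z i.
Proof.
case: k z => [|k] z ha a0 hz; first by rewrite big_ord0.
(* The induction needs this stronger form, where the whole sum is weighted by the last and smallest
   weight. *)
suff : a k * (\sum_i z i) <= \sum_(i < k.+1) a i * z i.
  apply: le_trans; rewrite mulr_ge0 ?a0 //.
  apply: le_trans (hz k.+1 (leqnn _)) _.
  by apply: ler_sum => i _; rewrite ltn_ord mul1r.
have {a0} : forall i, (i <= k)%N -> 0 <= a i by move=> i ik; apply: a0.
elim: k z ha hz => [|k IH] z ha hz a0; first by rewrite !big_ord1.
rewrite big_ord_recr [leRHS]big_ord_recr /= mulrDr lerD2r.
have hz' n : (n <= k.+1)%N ->
    0 <= \sum_(i < k.+1) (i < n)%:R * z (widen_ord (leqnSn _) i).
  move=> nk; have := hz n (leqW nk); rewrite big_ord_recr /=.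
  by rewrite [(k.+1 < n)%N]ltnNge nk /= mul0r addr0.
have := IH (fun i => z (widen_ord (leqnSn _) i)) _ hz' _.
move=> /(_ _ _) h; apply: le_trans (h _ _); last first.
- by move=> i ik; apply: a0; apply: leqW.
- by move=> i ik; apply: ha; apply: leqW.
apply: ler_wpM2r; last exact: ha.
apply: le_trans (hz' k.+1 (leqnn _)) _.
by apply: ler_sum => i _; rewrite ltn_ord mul1r.
Qed.

Lemma abel_sum_le k (a : nat -> R) (x y : 'I_k -> R) :
  (forall i, (i.+1 < k)%N -> a i.+1 <= a i) ->
  (forall i, (i < k)%N -> 0 <= a i) ->
  (forall n, (n <= k)%N ->
    \sum_(i < k) (i < n)%:R * x i <= \sum_(i < k) (i < n)%:R * y i) ->
  \sum_(i < k) a i * x i <= \sum_(i < k) a i * y i.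
Proof.
move=> ha a0 h; rewrite -subr_ge0 -sumrB.
under eq_bigr do rewrite -mulrBr.
apply: abel_sum_ge0 => // n nk.
have := h n nk; rewrite -subr_ge0 -sumrB.
by under eq_bigr do rewrite -mulrBr.
Qed.

Lemma sum_ord_lt k n (F : nat -> R) : (n <= k)%N ->
  \sum_(i < k) (i < n)%:R * F i = \sum_(i < n) F i.
Proof.
move=> nk; rewrite (big_ord_widen k F nk) [RHS]big_mkcond /=.
by apply: eq_bigr => i _; case: ifP; rewrite ?mul1r ?mul0r.
Qed.

(** The range is a lower half and an upper half read from the top; an odd [d] leaves over the index
    [d./2], whose term has to vanish. *)
Lemma sum_nat_fold d (F : nat -> R) :
  (odd d -> F d./2 = 0) ->
  \sum_(i < d) F i = \sum_(i < d./2) F i + \sum_(i < d./2) F (d - i.+1)%N.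
Proof.
move=> F0; rewrite -[in LHS](big_mkord xpredT F).
have h1 : (d./2 <= d - d./2)%N by lia.
have h2 : (d - d./2 <= d)%N by lia.
rewrite (big_cat_nat (leq0n _) h2) /= (big_cat_nat (leq0n _) h1) /= big_mkord.
rewrite [X in _ + X + _]big1_seq ?addr0; last first.
  move=> i /= /[!mem_index_iota] /andP[h3 h4].
  have odd_d : odd d by lia.
  by have -> : i = d./2 by [lia|]; exact: F0.
congr (_ + _); rewrite -{1}[(d - d./2)%N]add0n big_addn subKn; last by lia.
rewrite big_nat_rev /= big_mkord; apply: eq_bigr => i _.
by congr F; have := ltn_ord i; lia.
Qed.

End Abel.

(** * Bounding a linear functional by the spectral spread *)

Section Spread.
Variables (R : realType) (C : numClosedFieldType) (K : real_part R C).
Local Notation emb := (emb K).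
Local Notation ip := (ip K).
Local Notation rdiag := (rdiag K).

(* It suffices to test a real-linear functional killing the identity on the
   spectral projections: both halves of the spectrum of [A], measured from the
   middle eigenvalue, are summed by parts. *)
Lemma spread_bound d (U : 'M[C]_d) (lam : nat -> R) (phi : 'M[C]_d -> R)
    (tau : nat -> R) :
  U^h *m U = 1%:M ->
  (forall i, (i.+1 < d)%N -> lam i.+1 <= lam i) ->
  (forall A B, phi (A + B) = phi A + phi B) ->
  (forall (a : R) A, phi (emb a *: A) = a * phi A) ->
  phi 1%:M = 0 ->
  (forall J : pred 'I_d, `|phi (U^h *m rdiag (fun i => (J i)%:R) *m U)|
     <= \sum_(j < #|J|) tau j) ->
  phi (U^h *m rdiag (fun i : 'I_d => lam i) *m U) <=
    \sum_(j < d./2) tau j * (lam j - lam (d - j.+1)%N).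
Proof.
move=> Uu lamS phiD phiZ phi1 phiJ.
have lam_le := noninc_le lamS.
(* The values of [phi] at the rank-one spectral projections; on matrices diagonal in the same basis
   [phi] is a weighted sum of them. *)
pose g i := phi (U^h *m rdiag (fun j : 'I_d => (j == i :> nat)%:R) *m U).
have phi0 : phi 0 = 0 by have := phiZ 0 0; rewrite scaler0 mul0r.
have phi_sum (F : 'I_d -> 'M[C]_d) : phi (\sum_i F i) = \sum_i phi (F i).
  by apply: (big_morph phi phiD).
have phiE (a : nat -> R) :
    phi (U^h *m rdiag (fun i : 'I_d => a i) *m U) = \sum_(i < d) a i * g i.
  have -> : rdiag (fun i : 'I_d => a i) = \sum_(i < d)
      emb (a i) *: rdiag (fun j : 'I_d => (j == i :> nat)%:R).
    apply/matrixP => p q; rewrite summxE (bigD1 p) //= !mxE eqxx big1.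
      by rewrite addr0 mulrnAr rmorph1 mulr1.
    move=> i ip; rewrite !mxE eq_sym (negbTE (_ : i != p :> nat)) //.
    by rewrite mulr0n rmorph0 mul0rn mulr0.
  rewrite mulmx_sumr mulmx_suml phi_sum; apply: eq_bigr => i _.
  by rewrite -scalemxAr -scalemxAl phiZ.
(* Unit weights give the identity, which [phi] kills; hence the spectrum may be shifted by a
   constant. *)
have g0 : \sum_(i < d) g i = 0.
  have := phiE (fun=> 1); rewrite rdiag1 mulmx1 Uu phi1 => {2}->.
  by apply: eq_bigr => i _; rewrite mul1r.
(* Testing on the projection onto the first [n] eigenvectors bounds the partial sums of [g]; in
   [tail] the last [n] bound those of [- g] read from the end. *)
have head n : (n <= d./2)%N -> \sum_(i < n) g i <= \sum_(j < n) tau j.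
  move=> nd; have nd' : (n <= d)%N by lia.
  have := phiJ (fun i => (i < n)%N); rewrite (phiE (fun i => (i < n)%:R)).
  rewrite sum_ord_lt // => /(le_trans (ler_norm _)).
  have -> // : #|(fun i : 'I_d => (i < n)%N)| = n.
  by rewrite -sum1_card -(big_ord_widen d (fun=> 1%N)) // sum1_card card_ord.
have tail n : (n <= d./2)%N ->
    \sum_(i < n) - g (d - i.+1)%N <= \sum_(j < n) tau j.
  move=> nd; have nd' : (n <= d)%N by lia.
  have := phiJ (fun i => (d - i.+1 < n)%N).
  rewrite (phiE (fun i => (d - i.+1 < n)%:R)) -normrN => /(le_trans (ler_norm _)).
  rewrite (reindex_inj rev_ord_inj) /=.
  have -> : \sum_(i < d) (d - (d - i.+1).+1 < n)%:R * g (d - i.+1)%N =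
            \sum_(i < n) g (d - i.+1)%N.
    rewrite -(sum_ord_lt (fun i => g (d - i.+1)%N) nd').
    apply: eq_bigr => i _; congr (_%:R * _); congr nat_of_bool.
    by have := ltn_ord i; lia.
  rewrite sumrN; have -> // : #|(fun i : 'I_d => (d - i.+1 < n)%N)| = n.
  rewrite -sum1_card (reindex_inj rev_ord_inj) /= -[RHS]card_ord -sum1_card.
  rewrite (big_ord_widen d (fun=> 1%N) nd'); apply: eq_bigl => i.
  by have := ltn_ord i; rewrite /in_mem /=; lia.
(* The middle eigenvalue: [lam i - c] is non-negative on the lower half of the indices, non-positive
   on the upper half, and zero at the index left over for odd [d]. *)
pose c := lam d./2.
have -> : phi (U^h *m rdiag (fun i : 'I_d => lam i) *m U) =
          \sum_(i < d) (lam i - c) * g i.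
  rewrite phiE; under [RHS]eq_bigr do rewrite mulrBl.
  by rewrite sumrB -mulr_sumr g0 mulr0 subr0.
rewrite (sum_nat_fold (F := fun i => (lam i - c) * g i)); last first.
  by move=> _; rewrite subrr mul0r.
have -> : \sum_(j < d./2) tau j * (lam j - lam (d - j.+1)%N) =
    \sum_(j < d./2) (lam j - c) * tau j +
    \sum_(j < d./2) (c - lam (d - j.+1)%N) * tau j.
  by rewrite -big_split; apply: eq_bigr => j _ /=; ring.
apply: lerD.
  apply: (@abel_sum_le _ _ (fun i => lam i - c) (fun i => g i) (fun i => tau i)).
  - by move=> i hi; rewrite lerD2r lamS //; lia.
  - by move=> i hi; rewrite subr_ge0 lam_le //; lia.
  - by move=> n nd; rewrite !sum_ord_lt // head.
under eq_bigr => i _ do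
  rewrite -[(_ - c) * _]opprK -mulNr opprB -mulrN.
apply: (@abel_sum_le _ _ (fun i => c - lam (d - i.+1)%N)
         (fun i => - g (d - i.+1)%N) (fun i => tau i)).
- by move=> i hi; rewrite lerD2l lerN2 lam_le //; lia.
- by move=> i hi; rewrite subr_ge0 lam_le //; lia.
- move=> n nd; rewrite (sum_ord_lt (fun i => - g (d - i.+1)%N)) //.
  by rewrite sum_ord_lt // tail.
Qed.

End Spread.

(** * Frames, contractions and sign matrices *)

Section Frames.
Variables (R : realType) (C : numClosedFieldType) (K : real_part R C).
Local Notation re := (re K).
Local Notation rtr := (rtr K).
Local Notation ip := (ip K).
Local Notation contractive := (contractive K).
Local Notation rdiag := (rdiag K).

(* [Z] is only a partial isometry: its [j]-th column vanishes when the [j]-th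
   principal angle does, as [k] orthonormal vectors orthogonal to [X] need not
   exist. *)
Record frame d k (X Z : 'M[C]_(d, k)) (E : 'M[C]_k) : Prop := Frame {
  frame_XX : X^h *m X = 1%:M;
  frame_XZ : X^h *m Z = 0;
  frame_ZZ : Z^h *m Z = E;
  frame_ZE : Z *m E = Z }.

Lemma frame_ZX d k (X Z : 'M[C]_(d, k)) E : frame X Z E -> Z^h *m X = 0.
Proof. by move=> F; rewrite -[LHS]ctrK ctrM ctrK (frame_XZ F) ctr0. Qed.

(** Bessel's inequality: [X X^h + Z Z^h] is a Hermitian idempotent, since [Z Z^h Z = Z E = Z]. *)
Lemma frame_bessel d k (X Z : 'M[C]_(d, k)) E p (x : 'M[C]_(d, p)) :
  frame X Z E ->
  ip (X^h *m x) (X^h *m x) + ip (Z^h *m x) (Z^h *m x) <= ip x x.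
Proof.
move=> F; rewrite !(ip_mull _ _ x) !ctrK -ipDr !mulmxA -mulmxDl.
set Q := _ + _; have h := ip_le K x (Q *m x).
have Qh : Q^h = Q by rewrite ctrD !ctrM !ctrK.
have QQ : Q *m Q = Q.
  rewrite mulmxDl !mulmxDr !mulmxA -(mulmxA X) (frame_XX F) mulmx1.
  rewrite -(mulmxA X _ Z) (frame_XZ F) mulmx0 mul0mx addr0.
  rewrite -(mulmxA Z _ X) (frame_ZX F) mulmx0 mul0mx add0r.
  by rewrite -(mulmxA Z _ Z) (frame_ZZ F) (frame_ZE F).
by move: h; rewrite (ip_mull _ Q) Qh mulmxA QQ; lra.
Qed.

Lemma frame_contractive_X d k (X Z : 'M[C]_(d, k)) E :
  frame X Z E -> contractive X.
Proof. by move=> F; apply/isometry_contractive/(frame_XX F). Qed.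

Lemma frame_contractive_Z d k (X Z : 'M[C]_(d, k)) E :
  frame X Z E -> contractive Z.
Proof.
move=> F; rewrite -[Z]ctrK; apply: contractive_ctr; apply/contractiveP => p x.
by have := frame_bessel x F; have := ip_ge0 K (X^h *m x); lra.
Qed.

(** The equation [x ^+ 3 = x] encodes the values -1, 0 and 1 taken by the eigenvalues of [W]. *)
Lemma cube_cases (x : R) : x ^+ 3 = x -> x = 0 \/ x ^+ 2 = 1.
Proof.
move=> h; have /eqP : x * (x ^+ 2 - 1) = 0 by rewrite mulrBr mulr1 -exprS h subrr.
by rewrite mulf_eq0 subr_eq0 => /orP[/eqP|/eqP]; [left|right].
Qed.

(** By [a i ^+ 3 = a i] the diagonal matrix is its square times itself, so the trace becomes an
    inner product of [rdiag a] with [G] times its square; both diagonal matrices have squared norm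
    [\sum_i a i ^+ 2]. *)
Lemma rtr_rdiag_contractive n (a : 'I_n -> R) (G : 'M[C]_n) :
  (forall i, a i ^+ 3 = a i) -> contractive G ->
  rtr (rdiag a *m G) <= \sum_i a i ^+ 2.
Proof.
move=> ha hG.
have a2 i : a i ^+ 2 * a i ^+ 2 = a i ^+ 2.
  by case: (cube_cases (ha i)) => ->; rewrite ?expr0n /= ?mul0r ?mul1r.
have -> : rdiag a = rdiag (fun i => a i ^+ 2) *m rdiag a.
  by rewrite rdiagM; apply: eq_rdiag => i; rewrite -exprSr ha.
rewrite -mulmxA rtr_mulC -mulmxA.
have := contractive_ip (rdiag (fun i => a i ^+ 2)) (rdiag a) hG.
rewrite !ipE !ctr_rdiag !rdiagM !rtr_rdiag.
rewrite (eq_bigr (fun i => a i ^+ 2)) => [|i _]; last by rewrite -expr2.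
rewrite (eq_bigr (fun i => a i ^+ 2) (F1 := fun i => a i ^+ 2 * a i ^+ 2)) =>
  [|i _]; last by rewrite a2.
by lra.
Qed.

(** [2P - 1] is a Hermitian involution, hence unitary. *)
Lemma projection_reflection d (P : 'M[C]_d) :
  P^h = P -> P *m P = P -> contractive (P + P - 1%:M).
Proof.
move=> Ph PP; apply: isometry_contractive.
rewrite ctrB ctrD ctr1 Ph mulmxBl mul1mx !mulmxBr mulmx1 !mulmxDl !mulmxDr PP.
by rewrite addrK opprB addrC subrK.
Qed.

(** With [S = T^h T], contractivity of [T^h] bounds the squared norm of [S x] by [ip x (S x)], which
    is what expanding the square of [2 S x - x] calls for. *)
Lemma contractive_reflection m n (T : 'M[C]_(m, n)) :
  contractive T -> contractive (T^h *m T + T^h *m T - 1%:M).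
Proof.
move=> /contractiveP hT; apply/contractiveP => p x; set S := T^h *m T.
have h1 : ip (S *m x) (S *m x) <= ip (T *m x) (T *m x).
  rewrite -mulmxA; have /contractive_ctr/contractiveP := (contractiveP K T).2 hT.
  by apply.
have h2 : ip (T *m x) (T *m x) = ip x (S *m x) by rewrite ip_mull mulmxA.
rewrite mulmxBl mulmxDl mul1mx !(ipDl, ipDr, ipNl, ipNr) (ipC K (S *m x) x).
by move: h1 h2; lra.
Qed.

Lemma contractive_conj_sign k (Om : 'M[C]_k) (eps : 'I_k -> R) :
  Om^h *m Om = 1%:M -> (forall i, eps i ^+ 3 = eps i) ->
  contractive (Om *m rdiag eps *m Om^h).
Proof.
move=> /(isometry_contractive K) cOm eps3.
apply: contractiveM; last exact: contractive_ctr.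
apply: contractiveM => //; apply: contractive_rdiag => i.
by case: (cube_cases (eps3 i)) => ->; rewrite ?expr0n ?ler01.
Qed.

Lemma rtr_conj_sign_le k (Om : 'M[C]_k) (eps : 'I_k -> R) G :
  Om^h *m Om = 1%:M -> (forall i, eps i ^+ 3 = eps i) -> contractive G ->
  rtr (Om *m rdiag eps *m Om^h *m G) <= \sum_i eps i ^+ 2.
Proof.
move=> /(isometry_contractive K) cOm eps3 hG.
rewrite -mulmxA -mulmxA rtr_mulC -mulmxA.
apply: rtr_rdiag_contractive => //.
by apply: contractiveM => //; apply: contractiveM => //; apply: contractive_ctr.
Qed.

(** * Traces involving a projection [P] of rank [m] and a matrix [W] of trace norm at most [r] *)

Section Bounds.
Variables (d k : nat) (X Z : 'M[C]_(d, k)) (E : 'M[C]_k).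
Variables (W : 'M[C]_k) (r : nat).
Hypothesis F : frame X Z E.
Hypothesis W_contractive : contractive W.
Hypothesis rtr_W : forall G, contractive G -> rtr (W *m G) <= r%:R.

Let ind (n : nat) : 'M[C]_k := rdiag (fun i : 'I_k => (i < n)%:R).

Let ind_contractive n : contractive (ind n).
Proof.
apply: contractive_rdiag => i; case: (i < n)%N; rewrite ?expr0n ?expr1n //=.
Qed.

Let rtr_ind n G : contractive G -> rtr (ind n *m G) <= n%:R.
Proof.
move=> hG; have h : forall i : 'I_k, ((i < n)%:R ^+ 3 : R) = (i < n)%:R.
  by move=> i; case: (i < n)%N; rewrite ?expr0n ?expr1n.
apply: le_trans (rtr_rdiag_contractive h hG) _.
rewrite (eq_bigr (fun i : 'I_k => (i < n)%:R)) => [|i _]; last first.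
  by case: (i < n)%N; rewrite ?expr0n ?expr1n.
rewrite -natr_sum ler_nat -big_mkcond sum1_card.
rewrite -[leqRHS]card_ord -sum1_card -sum1_card.
case: (leqP n k) => nk.
  by rewrite (big_ord_widen k (fun=> 1%N) nk); apply: leqnn.
rewrite [leqRHS]sum1_card card_ord -[leqRHS]mul1n -[leqRHS]mul1n.
by rewrite sum1_card (leq_trans (max_card _)) // card_ord mul1n mul1n ltnW.
Qed.

Variables (P : 'M[C]_d) (m : nat).
Hypothesis Ph : P^h = P.
Hypothesis PP : P *m P = P.
Hypothesis Pm : rtr P = m%:R.

Let ipPP : ip P P = m%:R. Proof. by rewrite !ipE Ph PP. Qed.


Lemma offdiag_ind_bound n :
  2 * rtr (ind n *m (W *m (X^h *m P *m Z))) <= (minn n (minn m r))%:R.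
Proof.
have cX := frame_contractive_X F; have cZ := frame_contractive_Z F.
have cR := projection_reflection Ph PP.
(* As [X^h Z = 0], the reflection [2P - 1] may replace [2P], which absorbs the factor 2 into a
   contraction. *)
have e : 2 * rtr (ind n *m (W *m (X^h *m P *m Z))) =
    rtr (ind n *m (W *m (X^h *m (P + P - 1%:M) *m Z))).
  rewrite mulmxBr mulmxBl mulmx1 (frame_XZ F) subr0 mulmxDr mulmxDl.
  by rewrite !mulmxDr rtrD; ring.
have cG : contractive (X^h *m (P + P - 1%:M) *m Z).
  by apply: contractiveM => //; apply: contractiveM => //; apply: contractive_ctr.
rewrite !natr_min !le_min; apply/and3P; split.
- by rewrite e; apply: rtr_ind; apply: contractiveM.
(* Bound by [m]: the trace pairs [Z^h P] with [X^h P], whose squared norms add up to at most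
   [ip P P]. *)
- have -> : rtr (ind n *m (W *m (X^h *m P *m Z))) =
            ip (Z^h *m P) (ind n *m W *m (X^h *m P)).
    by rewrite ipE ctrM ctrK Ph [RHS]rtr_mulC !mulmxA -(mulmxA _ P P) PP.
  have cM : contractive (ind n *m W) by apply: contractiveM.
  apply: le_trans (contractive_ip _ _ cM) _.
  by rewrite addrC -ipPP; exact: (frame_bessel P F).
- rewrite e rtr_mulC -mulmxA; apply: rtr_W.
  by apply: contractiveM.
Qed.

Lemma diag_ind_bound n l :
  rtr (ind n *m (W *m (ind l *m (Z^h *m P *m Z) - X^h *m P *m X *m ind l)))
   <= (minn l (minn n (minn m r)))%:R.
Proof.
have cX := frame_contractive_X F; have cZ := frame_contractive_Z F.
have cP : contractive P.
  by apply/contractiveP => p x; rewrite ip_mull Ph mulmxA PP; have := ip_le K x (P *m x);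
    rewrite [X in _ <= _ + X]ip_mull Ph mulmxA PP; lra.
pose refl (Y : 'M[C]_(d, k)) := Y^h *m P *m Y + Y^h *m P *m Y - 1%:M.
have cR Y : contractive Y -> contractive (refl Y).
  move=> cY; have := contractive_reflection (contractiveM cP cY).
  by rewrite ctrM Ph !mulmxA -(mulmxA _ P P) PP.
have cRZ := cR Z cZ; have cRX := cR X cX.
pose M := ind l *m (Z^h *m P *m Z) - X^h *m P *m X *m ind l.
rewrite -/M; set G := rtr _.
(* The identity parts of the two reflections contribute [ind l] with opposite signs and cancel, so
   [2 G] is a sum of two traces of products of contractions. *)
have e : 2 * G = rtr (ind n *m (W *m (ind l *m refl Z))) +
                 rtr (ind n *m (W *m (- (refl X *m ind l)))).
  rewrite -rtrD -!mulmxDr.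
  have -> : ind l *m refl Z - refl X *m ind l = M + M.
    rewrite /refl mulmxBr mulmxBl mulmx1 mul1mx mulmxDr mulmxDl.
    by rewrite /M opprB addrA subrK opprD addrACA.
  by rewrite (mulmxDr W M M) (mulmxDr (ind n)) rtrD mulr_natl mulr2n.
have bound (b : R) : rtr (ind n *m (W *m (ind l *m refl Z))) <= b ->
    rtr (ind n *m (W *m (- (refl X *m ind l)))) <= b -> G <= b.
  by move: e; rewrite /G; lra.
rewrite !natr_min !le_min; apply/and4P; split.
- apply: bound.
    rewrite mulmxA rtr_mulC -mulmxA; apply: (rtr_ind l).
    by apply: contractiveM => //; apply: contractiveM.
  rewrite -mulNmx !mulmxA rtr_mulC; apply: (rtr_ind l).
  apply: contractiveM; last exact: contractiveN.
  by apply: contractiveM.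
- apply: bound; apply: (rtr_ind n); apply: contractiveM => //.
    exact: contractiveM.
  by apply: contractiveN; apply: contractiveM.
(* Bound by [m]: the two terms are quadratic in [Z^h P] and in [X^h P], and Bessel's inequality adds
   them up. *)
- rewrite /G /M !mulmxBr rtrB.
  have -> : rtr (ind n *m (W *m (ind l *m (Z^h *m P *m Z)))) =
            ip (Z^h *m P) (ind n *m W *m ind l *m (Z^h *m P)).
    by rewrite ipE ctrM ctrK Ph [RHS]rtr_mulC !mulmxA -(mulmxA _ P P) PP.
  have -> : rtr (ind n *m (W *m (X^h *m P *m X *m ind l))) =
            ip (X^h *m P) (ind l *m ind n *m W *m (X^h *m P)).
    rewrite ipE ctrM ctrK Ph [RHS]rtr_mulC !mulmxA -(mulmxA _ P P) PP.
    by rewrite [LHS]rtr_mulC !mulmxA.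
  have cM : contractive (ind n *m W *m ind l).
    by apply: contractiveM; first exact: contractiveM.
  have cN : contractive (- (ind l *m ind n *m W)).
    by apply: contractiveN; apply: contractiveM; first exact: contractiveM.
  have h1 := contractive_ip (Z^h *m P) (Z^h *m P) cM.
  have h2 := contractive_ip (X^h *m P) (X^h *m P) cN.
  rewrite mulNmx ipNr in h2.
  by have := frame_bessel P F; rewrite ipPP; lra.
- apply: bound; rewrite rtr_mulC -mulmxA; apply: rtr_W; apply: contractiveM => //.
    exact: contractiveM.
  by apply: contractiveN; apply: contractiveM.
Qed.

Let sum_ind n q : (n <= k)%N ->
  \sum_(i < k) (i < n)%:R * (i < q)%:R = (minn n q)%:R :> R.
Proof.
move=> nk; rewrite (sum_ord_lt (fun i => (i < q)%:R) nk).
case: (leqP n q) => nq.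
  rewrite (eq_bigr (fun=> 1)) => [|i _]; first by rewrite sumr_const card_ord.
  by rewrite (leq_trans (ltn_ord i) nq).
rewrite (eq_bigr (fun i : 'I_n => (i < q)%:R * 1)) => [|i _]; last by rewrite mulr1.
by rewrite (sum_ord_lt (fun=> 1) (ltnW nq)) sumr_const card_ord.
Qed.

Variable th : nat -> R.
Hypothesis thS : forall i, th i.+1 <= th i.
Hypothesis th0 : forall i, 0 <= th i.
Let T : 'M[C]_k := rdiag (fun i : 'I_k => th i).

Let eqW (x y : R) : x = y -> x <= y. Proof. by move=> ->. Qed.

(** Summation by parts replaces [T] by [ind n], and the bound [minn n (minn m r)] is the [n]-th
    partial sum of the indicator on the right. *)
Lemma offdiag_bound :
  2 * rtr (W *m (X^h *m P *m Z) *m T) <=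
    \sum_(i < k) th i * (i < minn m r)%:R.
Proof.
rewrite rtr_mulC rtr_mul_rdiag mulr_sumr.
rewrite [leLHS](_ : _ = \sum_(i < k) th i *
    (2 * re ((W *m (X^h *m P *m Z)) i i))); last first.
  by apply: eq_bigr => i _; ring.
apply: abel_sum_le => // n nk; rewrite sum_ind //.
apply: le_trans (offdiag_ind_bound n); rewrite rtr_mul_rdiag mulr_sumr.
by apply: ler_sum => i _; apply: eqW; ring.
Qed.

(* Summation by parts twice, in each of the two factors [T]. *)
Lemma diag_bound :
  rtr (W *m (T *m (Z^h *m P *m Z) - X^h *m P *m X *m T) *m T) <=
    \sum_(i < k) th i * (th i * (i < minn m r)%:R).
Proof.
rewrite rtr_mulC rtr_mul_rdiag.
apply: abel_sum_le => // n nk.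
rewrite [leRHS](_ : _ = \sum_(i < k) th i * (i < minn n (minn m r))%:R); last first.
  by apply: eq_bigr => i _; rewrite (leq_min _ n) -mulnb natrM; ring.
rewrite -rtr_mul_rdiag.
(* The outer [T] has become [ind n]; cycling the trace brings the inner [T] to the front for the
   second summation. *)
pose P2 := Z^h *m P *m Z *m ind n *m W; pose P1 := ind n *m W *m (X^h *m P *m X).
rewrite [leLHS](_ : _ = rtr (T *m (P2 - P1))); last first.
  rewrite !mulmxBr !rtrB; congr (_ - _).
    by rewrite mulmxA rtr_mulC /P2 !mulmxA.
  by rewrite /P1 !mulmxA rtr_mulC !mulmxA.
rewrite rtr_mul_rdiag; apply: abel_sum_le => // l lk.
rewrite sum_ind // -rtr_mul_rdiag; apply: le_trans (diag_ind_bound n l).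
apply: eqW; rewrite !mulmxBr !rtrB; congr (_ - _).
  by rewrite /P2 [in RHS]mulmxA [RHS]rtr_mulC !mulmxA.
by rewrite /P1 !mulmxA [RHS]rtr_mulC !mulmxA.
Qed.

End Bounds.
End Frames.

(** * Ordered spectral theorem and the inequalities of Weyl, Lidskii and Mirsky *)

Section Mirsky.
Variables (R : realType) (C : numClosedFieldType) (K : real_part R C).
Local Notation re := (re K).
Local Notation emb := (emb K).
Local Notation rtr := (rtr K).
Local Notation ip := (ip K).
Local Notation rdiag := (rdiag K).

(** The eigenvalues may be listed in any order, because a permutation matrix is absorbed in the
    unitary factor. *)
Lemma spectral_perm n (M : 'M[C]_n) (s : seq R) :
  M \is hermsymmx ->
  perm_eq s [seq re (spectral_diag M 0 i) | i <- enum 'I_n] ->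
  exists2 U : 'M[C]_n, U^h *m U = 1%:M &
    M = U *m rdiag (fun i : 'I_n => s`_i) *m U^h.
Proof.
move=> Mh.
have /orthomx_spectralP := hermitian_normalmx Mh.
have Du := spectral_unitarymx M; rewrite invmx_unitary //.
have Dr := hermitian_spectral_diag_real Mh.
set Q := spectralmx M in Du *; set D := spectral_diag M in Dr * => ME.
pose t := [tuple re (D 0 i) | i < n].
have -> : [seq re (D 0 i) | i <- enum 'I_n] = t by [].
move=> /tuple_permP[sg ->].
pose S : 'M[C]_n := perm_mx sg.
have Sh : S^h = S^T by rewrite /ctr -map_trmx map_perm_mx.
have SS : S^h *m S = 1%:M by rewrite Sh tr_perm_mx -perm_mxM mulVg perm_mx1.
have QQ : Q *m Q^h = 1%:M by apply/unitarymxP.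
have SS' : S *m S^h = 1%:M by apply: mulmx1C.
exists (Q^h *m S^h); rewrite ctrM !ctrK.
  by rewrite !mulmxA -(mulmxA S) QQ mulmx1.
set Ds := rdiag _; have -> : Ds = S *m diag_mx D *m S^h.
  rewrite Sh tr_perm_mx -row_permE -col_permE.
  apply/matrixP => i j; rewrite rdiagE !mxE (inj_eq perm_inj).
  have -> : [seq tnth t (sg i0) | i0 <- enum 'I_n]`_i = re (D 0 (sg i)).
    by rewrite (nth_map i) ?size_enum_ord // nth_ord_enum tnth_mktuple.
  by rewrite emb_re //; move/mxOverP: Dr; apply.
by rewrite !mulmxA -(mulmxA _ S^h S) SS mulmx1 -(mulmxA _ S^h S) SS mulmx1.
Qed.

Lemma hermsymmxP n (M : 'M[C]_n) : reflect (M^h = M) (M \is hermsymmx).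
Proof.
apply: (iffP (is_hermitianmxP _ _ _)); rewrite expr0 scale1r => h.
  by rewrite [RHS]h.
by rewrite -[LHS]h.
Qed.

Lemma sort_dec_sorted (s : seq R) i :
  (i.+1 < size s)%N -> (sort_dec s)`_i.+1 <= (sort_dec s)`_i.
Proof.
move=> hi; have tot : total (fun x y : R => y <= x) by move=> x y; apply: le_total.
have := sort_sorted tot s; rewrite -/(sort_dec s) => /(sortedP 0) h.
by apply: h; rewrite size_sort.
Qed.

Lemma spectral_sorted n (M : 'M[C]_n) : M^h = M ->
  exists U : 'M[C]_n, exists2 a : nat -> R,
    (forall i, (i.+1 < n)%N -> a i.+1 <= a i) &
    U^h *m U = 1%:M /\ M = U *m rdiag (fun i : 'I_n => a i) *m U^h.
Proof.
move=> /hermsymmxP Mh.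
set l := [seq re (spectral_diag M 0 i) | i <- enum 'I_n].
have [|U Uu ME] := spectral_perm Mh (s := sort_dec l).
  by rewrite perm_sort.
exists U, (nth 0 (sort_dec l)); last by [].
by move=> i hi; apply: sort_dec_sorted; rewrite size_map size_enum_ord.
Qed.

Lemma ip_conj_rdiag n p (U : 'M[C]_n) (a : 'I_n -> R) (x : 'M[C]_(n, p)) :
  ip x (U *m rdiag a *m U^h *m x) =
  \sum_i a i * ip (row i (U^h *m x)) (row i (U^h *m x)).
Proof.
by rewrite -ip_rdiag [RHS]ip_mull ctrK !mulmxA.
Qed.

Lemma ip_rows n p (x : 'M[C]_(n, p)) : ip x x = \sum_i ip (row i x) (row i x).
Proof.
rewrite -{2}[x]mul1mx -(rdiag1 K) ip_rdiag.
by apply: eq_bigr => i _; rewrite mul1r.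
Qed.

(** Weyl's monotonicity principle, by comparing Rayleigh quotients at one suitable vector. *)
Lemma weyl_monotone n (P Q U V : 'M[C]_n) (p q : nat -> R) :
  U^h *m U = 1%:M -> V^h *m V = 1%:M ->
  (forall i, (i.+1 < n)%N -> p i.+1 <= p i) ->
  (forall i, (i.+1 < n)%N -> q i.+1 <= q i) ->
  P = U *m rdiag (fun i : 'I_n => p i) *m U^h ->
  Q = V *m rdiag (fun i : 'I_n => q i) *m V^h ->
  (forall x : 'cV[C]_n, ip x (P *m x) <= ip x (Q *m x)) ->
  forall i : 'I_n, p i <= q i.
Proof.
move=> Uu Vu /noninc_le pS /noninc_le qS PE QE PQ i.
(* A vector in the span of the first [i+1] eigenvectors of [P] orthogonal to
   the first [i] ones of [Q]: a square system with one zero row. *)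
pose M : 'M[C]_n := \matrix_(a, b)
  if (a < i)%N then (V^h *m U) a b else if (a == i) then 0 else (a == b)%:R.
have detM : \det M^T == 0.
  rewrite det_tr; apply/det0P; exists (delta_mx 0 i).
    by apply/eqP => /matrixP/(_ 0 i); rewrite !mxE !eqxx => /eqP; rewrite oner_eq0.
  by rewrite -rowE; apply/rowP => b; rewrite !mxE ltnn eqxx.
have /det0P[v v0 vM] := detM.
pose y := v^T; have My : M *m y = 0 by rewrite -[M]trmxK -trmx_mul vM trmx0.
have y_gt (j : 'I_n) : (i < j)%N -> row j y = 0.
  move=> ij; have jNi : (j == i) = false by rewrite -val_eqE; apply: gtn_eqF.
  apply/rowP => c; rewrite !mxE.
  have /matrixP/(_ j c) := My; rewrite !mxE.
  rewrite (bigD1 j) //= big1 ?addr0; last first.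
    by move=> b bj; rewrite !mxE ltnNge (ltnW ij) jNi eq_sym (negbTE bj) mul0r.
  by rewrite !mxE ltnNge (ltnW ij) jNi eqxx mul1r.
have z_lt (j : 'I_n) : (j < i)%N -> row j (V^h *m (U *m y)) = 0.
  move=> ji; rewrite mulmxA; apply/rowP => c; rewrite mxE [RHS]mxE.
  have /matrixP/(_ j c) := My; rewrite [RHS]mxE mxE => <-; rewrite mxE.
  by apply: eq_bigr => b _; rewrite [in RHS]mxE ji.
have y0 : 0 < ip y y.
  rewrite lt_def ip_ge0 andbT; apply: contraNneq v0 => /ip_eq0 y0.
  by rewrite -[v]trmxK -/y y0 trmx0.
have VV : V *m V^h = 1%:M by apply: mulmx1C.
have zz : ip (V^h *m (U *m y)) (V^h *m (U *m y)) = ip y y.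
  by rewrite ip_mull ctrK mulmxA VV mul1mx ip_mull mulmxA Uu mul1mx.
(* At [U *m y] the form of [P] involves only its eigenvalues of index at most [i], that of [Q] only
   those of index at least [i]. *)
have := PQ (U *m y); rewrite PE QE !ip_conj_rdiag.
rewrite (mulmxA U^h) Uu mul1mx => h.
have h1 : p i * ip y y <= \sum_(j < n) p j * ip (row j y) (row j y).
  rewrite [ip y y]ip_rows mulr_sumr; apply: ler_sum => j _.
  have [ij|ji] := ltnP i j; first by rewrite y_gt // ipE mulmx0 rtr0 !mulr0.
  by rewrite ler_wpM2r ?ip_ge0 // pS.
have h2 : \sum_(j < n) q j * ip (row j (V^h *m (U *m y))) (row j (V^h *m (U *m y)))
    <= q i * ip y y.
  rewrite -zz [ip (_ *m _) _]ip_rows mulr_sumr; apply: ler_sum => j _.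
  have [ji|ij] := ltnP j i; first by rewrite z_lt // ipE mulmx0 rtr0 !mulr0.
  by rewrite ler_wpM2r ?ip_ge0 // qS.
by rewrite -(ler_pM2r y0); apply: le_trans h1 (le_trans h h2).
Qed.

(** Let [E] be the part of [P - Q] exceeding [mu]. The eigenvalues [q'] of [Q + E] dominate both [q]
    and [p - mu] by Weyl, so on [I] the difference [p - q] is at most [(q' - q) + mu], and the
    non-negative numbers [q' - q] sum to the trace of [E]. *)
Lemma lidskii n (P Q Om U V : 'M[C]_n) (p q : nat -> R) (dl : 'I_n -> R)
    (I L : pred 'I_n) (mu : R) :
  U^h *m U = 1%:M -> V^h *m V = 1%:M -> Om^h *m Om = 1%:M ->
  (forall i, (i.+1 < n)%N -> p i.+1 <= p i) ->
  (forall i, (i.+1 < n)%N -> q i.+1 <= q i) ->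
  P = U *m rdiag (fun i : 'I_n => p i) *m U^h ->
  Q = V *m rdiag (fun i : 'I_n => q i) *m V^h ->
  P - Q = Om *m rdiag dl *m Om^h ->
  #|L| = #|I| ->
  (forall l, L l -> mu <= dl l) -> (forall l, ~~ L l -> dl l <= mu) ->
  \sum_(i < n | I i) (p i - q i) <= \sum_(l < n | L l) dl l.
Proof.
move=> Uu Vu Omu pS qS PE QE PQ LI muL muNL.
pose e l := if L l then dl l - mu else 0.
pose E := Om *m rdiag e *m Om^h.
have conj_h (T : 'M[C]_n) a : (T *m rdiag a *m T^h)^h = T *m rdiag a *m T^h.
  by rewrite !ctrM ctrK ctr_rdiag mulmxA.
have rtr_conj (T : 'M[C]_n) a : T^h *m T = 1%:M ->
    rtr (T *m rdiag a *m T^h) = \sum_i a i.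
  by move=> Tu; rewrite rtr_mulC mulmxA Tu mul1mx rtr_rdiag.
have QEh : (Q + E)^h = Q + E by rewrite ctrD QE !conj_h.
have [V' [q' q'S [V'u QEE]]] := spectral_sorted QEh.
have h1 := weyl_monotone Vu V'u qS q'S QE QEE.
have {h1}qq' : forall i : 'I_n, q i <= q' i.
  apply: h1 => x; rewrite mulmxDl ipDr lerDl ip_conj_rdiag sumr_ge0 // => l _.
  rewrite mulr_ge0 ?ip_ge0 // /e; case: ifP => // Ll.
  by rewrite subr_ge0 muL.
have V'V' : V' *m V'^h = 1%:M by apply: mulmx1C.
have QEE' : Q + E + (emb mu)%:M =
    V' *m rdiag (fun i : 'I_n => q' i + mu) *m V'^h.
  rewrite QEE -(rdiagD K _ (fun=> mu)) mulmxDr mulmxDl; congr (_ + _).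
  by rewrite rdiag_cst mul_mx_scalar -scalemxAl V'V' scalemx1.
have pq' : forall i : 'I_n, p i <= q' i + mu.
  have q'muS i : (i.+1 < n)%N -> q' i.+1 + mu <= q' i + mu.
    by move=> hi; rewrite lerD2r q'S.
  apply: (weyl_monotone (q := fun i => q' i + mu) Uu V'u pS q'muS PE QEE').
  move=> x; have -> : P = Q + Om *m rdiag dl *m Om^h by rewrite -PQ addrC subrK.
  rewrite -addrA !(mulmxDl Q) !ipDr lerD2l.
  have -> : E + (emb mu)%:M = Om *m rdiag (fun l => e l + mu) *m Om^h.
    rewrite -(rdiagD K _ (fun=> mu)) mulmxDr mulmxDl; congr (_ + _).
    have OO : Om *m Om^h = 1%:M by apply: mulmx1C.
    by rewrite rdiag_cst mul_mx_scalar -scalemxAl OO scalemx1.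
  rewrite !ip_conj_rdiag; apply: ler_sum => l _.
  rewrite ler_wpM2r ?ip_ge0 // /e; case: ifPn => [_|Ll].
    by rewrite subrK.
  by rewrite add0r muNL.
have sum_q' : \sum_(i < n) (q' i - q i) = \sum_(l < n | L l) (dl l - mu).
  have h : rtr (Q + E) = \sum_(i < n) q' i by rewrite QEE rtr_conj.
  rewrite rtrD QE !rtr_conj // in h.
  by rewrite sumrB -h addrC addKr -big_mkcond.
(* Since [L] and [I] have the same size, [mu] may be counted over [I] instead of [L]. *)
have -> : \sum_(l < n | L l) dl l =
    \sum_(l < n | L l) (dl l - mu) + \sum_(i < n | I i) mu.
  by rewrite !sumr_const -LI sumrB sumr_const subrK.
rewrite -sum_q'; apply: le_trans (_ : \sum_(i < n | I i) ((q' i - q i) + mu) <= _).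
  by apply: ler_sum => i _; have := pq' i; lra.
rewrite big_split lerD2r [leRHS](bigID I) /= lerDl.
by apply: sumr_ge0 => i _; rewrite subr_ge0.
Qed.

(** The set [I] splits by the sign of [q i - p i]. Lidskii bounds the [a] indices of one kind by the
    [a] largest eigenvalues of [Q - P], the [b] others by minus its [b] smallest; the signs [eps]
    collect both in one trace. *)
Lemma mirsky n (P Q U V : 'M[C]_n) (p q : nat -> R) (I : pred 'I_n) :
  U^h *m U = 1%:M -> V^h *m V = 1%:M ->
  (forall i, (i.+1 < n)%N -> p i.+1 <= p i) ->
  (forall i, (i.+1 < n)%N -> q i.+1 <= q i) ->
  P = U *m rdiag (fun i : 'I_n => p i) *m U^h ->
  Q = V *m rdiag (fun i : 'I_n => q i) *m V^h ->
  exists Om : 'M[C]_n, exists eps : 'I_n -> R,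
    [/\ Om^h *m Om = 1%:M, forall i, eps i ^+ 3 = eps i,
        \sum_i eps i ^+ 2 = #|I|%:R &
        \sum_(i < n | I i) `|p i - q i| <=
          rtr ((Q - P) *m (Om *m rdiag eps *m Om^h))].
Proof.
move=> Uu Vu pS qS PE QE.
have conj_h (T : 'M[C]_n) a : (T *m rdiag a *m T^h)^h = T *m rdiag a *m T^h.
  by rewrite !ctrM ctrK ctr_rdiag mulmxA.
have Dh : (Q - P)^h = Q - P by rewrite ctrB PE QE !conj_h.
have [Om [dl dlS [Omu DE]]] := spectral_sorted Dh.
have dl_le := noninc_le dlS.
pose Ip : pred 'I_n := fun i => I i && (p i <= q i).
pose Im : pred 'I_n := fun i => I i && (q i < p i).
pose a := #|Ip|; pose b := #|Im|.
have abI : (a + b = #|I|)%N.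
  rewrite /a /b -!sum1_card (bigID (fun i : 'I_n => p i <= q i) (mem I)) /=.
  by congr addn; apply: eq_bigl => i; rewrite /in_mem //= /Im ltNge.
have abn : (a + b <= n)%N by rewrite abI -[leqRHS]card_ord max_card.
have card_lt c : (c <= n)%N -> #|(fun l : 'I_n => (l < c)%N)| = c.
  by move=> cn; rewrite -sum1_card -(big_ord_widen n (fun=> 1%N)) // sum1_card card_ord.
have card_ge c : (c <= n)%N -> #|(fun l : 'I_n => (n - c <= l)%N)| = c.
  move=> cn; rewrite -[RHS](card_lt c) // -!sum1_card (reindex_inj rev_ord_inj) /=.
  by apply: eq_bigl => l; have := ltn_ord l; rewrite /in_mem /=; lia.
(* The two ranges are disjoint because [a + b <= n]. *)
pose eps (l : 'I_n) : R := (l < a)%:R - (n - b <= l)%:R.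
have epsE (l : 'I_n) : [\/ [/\ (l < a)%N = true, (n - b <= l)%N = false & eps l = 1],
    [/\ (l < a)%N = false, (n - b <= l)%N = true & eps l = -1] |
    [/\ (l < a)%N = false, (n - b <= l)%N = false & eps l = 0]].
  have := ltn_ord l; rewrite /eps.
  case h1: (l < a)%N; case h2: (n - b <= l)%N => ln; rewrite ?subr0 ?sub0r.
  - by exfalso; lia.
  - by constructor 1.
  - by constructor 2.
  - by constructor 3.
have eps2 : \sum_i eps i ^+ 2 = #|I|%:R.
  have nat_card (L : pred 'I_n) : \sum_(l < n) (L l)%:R = #|L|%:R :> R.
    by rewrite -sum1_card natr_sum [RHS]big_mkcond; apply: eq_bigr => l _;
      rewrite /in_mem /=; case: (L l).
  rewrite -abI natrD -[in a%:R](card_lt a); last by lia.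
  rewrite -[in b%:R](card_ge b); last by lia.
  rewrite -!nat_card -big_split /=; apply: eq_bigr => l _.
  by case: (epsE l) => -[-> -> ->]; rewrite ?sqrrN ?expr1n ?expr0n ?addr0 ?add0r.
exists Om, eps; split=> //.
  move=> l; case: (epsE l) => -[_ _ ->]; rewrite ?expr1n ?expr0n //.
  by rewrite exprSr sqrrN expr1n mul1r.
have -> : rtr ((Q - P) *m (Om *m rdiag eps *m Om^h)) =
    \sum_(l < n | (l < a)%N) dl l + \sum_(l < n | (n - b <= l)%N) - dl l.
  rewrite DE !mulmxA -(mulmxA _ Om^h Om) Omu mulmx1 rtr_mulC !mulmxA Omu mul1mx.
  rewrite rdiagM rtr_rdiag [X in _ = X + _]big_mkcond [X in _ + X]big_mkcond.
  rewrite -big_split /=; apply: eq_bigr => l _.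
  by case: (epsE l) => -[-> -> ->]; rewrite ?mulr1 ?mulrN1 ?mulr0 ?addr0 ?add0r.
rewrite (bigID (fun i : 'I_n => p i <= q i)) /=; apply: lerD.
  rewrite (eq_bigr (fun i : 'I_n => q i - p i)); last first.
    by move=> i /andP[_ h]; rewrite distrC ger0_norm // subr_ge0.
  (* The threshold is the smallest of the [a] largest eigenvalues; for [a = 0] it is the largest
     eigenvalue and no index is selected. *)
  apply: (lidskii (I := Ip) (mu := dl a.-1) Vu Uu Omu qS pS QE PE DE).
  - by apply: card_lt; lia.
  - by move=> l la; apply: dl_le; lia.
  - move=> l; rewrite -leqNgt => al; apply: dl_le => //; lia.
rewrite (eq_bigr (fun i : 'I_n => p i - q i)); last first.
  by move=> i /andP[_ h]; rewrite ger0_norm // subr_ge0 ltW // ltNge.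
rewrite (eq_bigl Im) => [|i]; last by rewrite /Im ltNge.
have DE' : P - Q = Om *m rdiag (fun l : 'I_n => - dl l) *m Om^h.
  by rewrite -(rdiagN K (fun l : 'I_n => dl l)) mulmxN mulNmx -DE opprB.
(* The minimum keeps the index in range when [b = 0]. *)
apply: (lidskii (mu := - dl (minn (n - b) n.-1)) Uu Vu Omu pS qS PE QE DE').
- by apply: card_ge; lia.
- by move=> l bl; rewrite lerN2; apply: dl_le => //; lia.
- by move=> l; rewrite -ltnNge => lb; rewrite lerN2; apply: dl_le; have := ltn_ord l; lia.
Qed.

End Mirsky.

(** * Orthonormal completion and principal vectors *)

Section PrincipalFrame.
Variables (R : realType) (C : numClosedFieldType) (K : real_part R C).
Local Notation re := (re K).
Local Notation emb := (emb K).
Local Notation ip := (ip K).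
Local Notation rdiag := (rdiag K).

Lemma ctr_mul_self n (y : 'cV[C]_n) : y^h *m y = (emb (ip y y))%:M.
Proof.
rewrite [LHS]mx11_scalar; congr _%:M.
have -> : ip y y = re ((y^h *m y) 0 0) by rewrite ipE /rtr /mxtrace big_ord1.
rewrite emb_re // mxE; apply: sum_real => i _.
by rewrite ctrE mulrC -normCK; apply: realX; apply: normr_real.
Qed.

Lemma col_gram m n p (A : 'M[C]_(m, n)) (B : 'M[C]_(m, p)) i j :
  (A^h *m B) i j = ((col i A)^h *m col j B) 0 0.
Proof. by rewrite !mxE; apply: eq_bigr => a _; rewrite !ctrE !mxE. Qed.

(** Columns outside [S] are replaced one at a time, by induction on their number. *)
Lemma extend_orthonormal n (S : {set 'I_n}) (B : 'M[C]_n) :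
  {in S &, forall i j, (B^h *m B) i j = (i == j)%:R} ->
  exists2 V : 'M[C]_n, V^h *m V = 1%:M & {in S, forall j, col j V = col j B}.
Proof.
move: {2}#|~: S| (leqnn #|~: S|) => m; elim: m S B => [|m IH] S B hm hB.
  exists B => //; apply/matrixP => i j.
  have inS l : l \in S.
    apply/negPn; rewrite -in_setC; move: hm.
    by rewrite leqn0 cards_eq0 => /eqP ->; rewrite inE.
  by rewrite hB // !mxE.
have [/eqP S0|/set0Pn[i0 i0S]] := boolP (~: S == set0).
  by apply: (IH S) => //; rewrite S0 cards0.
rewrite inE in i0S.
(* The row at [i0] is zero, so [N] has a nonzero kernel vector, which the rows in [S] make
   orthogonal to the columns kept. *)
pose N : 'M[C]_n := \matrix_(a, b) if a \in S then B^h a b else 0.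
have /det0P[v v0 vN] : \det N^T == 0.
  rewrite det_tr; apply/det0P; exists (delta_mx 0 i0).
    by apply/eqP => /matrixP/(_ 0 i0); rewrite !mxE !eqxx => /eqP; rewrite oner_eq0.
  by rewrite -rowE; apply/rowP => b; rewrite !mxE (negbTE i0S).
pose y := v^T; have Ny : N *m y = 0 by rewrite -[N]trmxK -trmx_mul vN trmx0.
have y0 : 0 < ip y y.
  rewrite lt_def ip_ge0 andbT; apply: contraNneq v0 => /ip_eq0 y0.
  by rewrite -[v]trmxK -/y y0 trmx0.
pose x := emb ((Num.sqrt (ip y y))^-1) *: y.
have xx : x^h *m x = 1%:M.
  have -> : x^h = emb ((Num.sqrt (ip y y))^-1) *: y^h.
    by apply/matrixP => a b; rewrite ctrE [x _ _]mxE [RHS]mxE ctrE rmorphM /= conj_emb.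
  rewrite -scalemxAl -scalemxAr ctr_mul_self !scale_scalar_mx -!rmorphM.
  rewrite mulrA -invfM -expr2 sqr_sqrtr ?ltW // mulVf ?gt_eqF //.
  by rewrite rmorph1.
have Bx i : i \in S -> (col i B)^h *m x = 0.
  move=> iS; rewrite -scalemxAr; have -> : (col i B)^h *m y = 0; last by rewrite scaler0.
  apply/matrixP => a b; have /matrixP/(_ i b) := Ny; rewrite ord1 !mxE => {2}<-.
  by apply: eq_bigr => c _; rewrite !mxE iS.
pose B' : 'M[C]_n := \matrix_(a, b) if b == i0 then x a 0 else B a b.
have colB'0 : col i0 B' = x by apply/colP => a; rewrite !mxE eqxx.
have colB' i : i \in S -> col i B' = col i B.
  move=> iS; apply/colP => a; rewrite !mxE; case: eqP => // ii0.
  by rewrite -ii0 iS in i0S.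
have [] := IH (i0 |: S) B'.
- rewrite -ltnS; apply: leq_trans hm; apply: proper_card.
  apply/properP; split; first by rewrite setCS subsetUr.
  by exists i0; rewrite !inE ?eqxx.
- move=> i j; rewrite !inE => /orP[/eqP ->|iS] /orP[/eqP ->|jS]; rewrite col_gram.
  + by rewrite colB'0 xx !mxE !eqxx.
  + rewrite colB'0 colB' //; have -> : x^h *m col j B = ((col j B)^h *m x)^h.
      by rewrite ctrM ctrK.
    rewrite Bx // ctr0 mxE; case: eqP => // ij.
    by rewrite ij jS in i0S.
  + rewrite colB'0 colB' // Bx // mxE; case: eqP => // ij.
    by rewrite -ij iS in i0S.
  + by rewrite !colB' // -col_gram hB.
- move=> V Vu hV; exists V => // j jS.
  by rewrite hV ?colB' // !inE jS orbT.
Qed.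

(** The columns of [M] are orthogonal; the nonzero ones, divided by [c], are orthonormal and extend
    to a unitary matrix. *)
Lemma svd_of_gram n (M : 'M[C]_n) (c : 'I_n -> R) :
  M^h *m M = rdiag (fun i => c i ^+ 2) ->
  exists2 V : 'M[C]_n, V^h *m V = 1%:M & M = V *m rdiag c.
Proof.
move=> hM; pose B := M *m rdiag (fun i => (c i)^-1).
have [] := @extend_orthonormal n [set i | c i != 0] B.
  move=> i j; rewrite !inE => ci cj.
  rewrite ctrM ctr_rdiag mulmxA -(mulmxA _ M^h) hM !rdiagM rdiagE.
  case: eqP => _; last by rewrite mulr0n.
  by rewrite expr2 mulrA mulVf // mul1r mulfV // rmorph1.
move=> V Vu hV; exists V => //.
apply/matrixP => a b; rewrite mul_mx_rdiagE.
(* Where [c b] vanishes so does column [b] of [M], whatever column [V] has there. *)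
have [cb|cb] := eqVneq (c b) 0.
  rewrite cb rmorph0 mul0r.
  have : M *m rdiag (fun i => (i == b)%:R) = 0.
    apply: (ip_eq0 (K := K)); rewrite ipE ctrM ctr_rdiag mulmxA -(mulmxA _ M^h) hM.
    rewrite !rdiagM rtr_rdiag big1 // => i _.
    by case: eqP => [->|_]; rewrite ?cb ?expr0n ?mulr0 ?mul0r.
  by move=> /matrixP/(_ a b); rewrite mul_mx_rdiagE mxE eqxx rmorph1 mul1r.
have : (col b V) a 0 = (col b B) a 0 by rewrite hV // inE.
rewrite [LHS]mxE [RHS]mxE => ->; rewrite mul_mx_rdiagE mulrA -rmorphM mulfV //.
by rewrite rmorph1 mul1r.
Qed.

(** Cosine-sine decomposition: [V] comes from the singular value decomposition of [X^h Y U], and [Z]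
    normalizes the component of [Y U] orthogonal to [X V], whose Gram matrix is one minus the
    squared cosines. *)
Lemma principal_frame d k (X Y : 'M[C]_(d, k)) (U : 'M[C]_k) (th : nat -> R) :
  X^h *m X = 1%:M -> Y^h *m Y = 1%:M -> U^h *m U = 1%:M ->
  (X^h *m Y)^h *m (X^h *m Y) =
    U *m rdiag (fun i : 'I_k => cos (th i) ^+ 2) *m U^h ->
  (forall i : 'I_k, (sin (th i) == 0) = (th i == 0)) ->
  exists V : 'M[C]_k, exists2 Z : 'M[C]_(d, k),
    V^h *m V = 1%:M /\ frame (X *m V) Z (rdiag (fun i : 'I_k => (th i != 0)%:R)) &
    Y *m U = X *m V *m rdiag (fun i : 'I_k => cos (th i)) +
             Z *m rdiag (fun i : 'I_k => sin (th i)).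
Proof.
move=> Xi Yi Uu hM sin0.
set c := rdiag (fun i : 'I_k => cos (th i)).
have UU : U *m U^h = 1%:M by apply: mulmx1C.
have [|V Vu MV] := @svd_of_gram _ (X^h *m Y *m U) (fun i : 'I_k => cos (th i)).
  rewrite ctrM -mulmxA (mulmxA _ _ U) hM !mulmxA Uu mul1mx.
  by rewrite -mulmxA Uu mulmx1.
have VV : V *m V^h = 1%:M by apply: mulmx1C.
set X' := X *m V; have X'i : X'^h *m X' = 1%:M.
  by rewrite /X' ctrM mulmxA -(mulmxA _ X^h X) Xi mulmx1.
have X'Y : X'^h *m (Y *m U) = c.
  by rewrite /X' ctrM -!mulmxA (mulmxA X^h) MV mulmxA Vu mul1mx.
pose G := Y *m U - X' *m c.
have X'G : X'^h *m G = 0 by rewrite mulmxBr X'Y mulmxA X'i mul1mx subrr.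
have GG : G^h *m G = rdiag (fun i : 'I_k => sin (th i) ^+ 2).
  rewrite {1}/G ctrB mulmxBl [X in _ - X](_ : _ = 0); last first.
    by rewrite ctrM -mulmxA X'G mulmx0.
  rewrite subr0 mulmxBr.
  have -> : (Y *m U)^h *m (Y *m U) = 1%:M.
    by rewrite ctrM mulmxA -(mulmxA _ Y^h Y) Yi mulmx1.
  have -> : (Y *m U)^h *m (X' *m c) = c *m c.
    by rewrite mulmxA -{1}[X']ctrK -ctrM X'Y ctr_rdiag.
  rewrite rdiagM -(rdiag1 K) rdiagN rdiagD; apply: eq_rdiag => i.
  by rewrite -expr2 sin2cos2.
set E := rdiag (fun i : 'I_k => (th i != 0)%:R).
have GE : G *m E = G.
  have : G *m rdiag (fun i : 'I_k => 1 - (th i != 0)%:R) = 0.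
    apply: (ip_eq0 (K := K)); rewrite ipE ctrM ctr_rdiag mulmxA -(mulmxA _ G^h) GG.
    rewrite !rdiagM rtr_rdiag big1 // => i _.
    have := sin0 i; case: (th i == 0) => [/eqP ->|_] /=.
      by rewrite expr0n mulr0 mul0r.
    by rewrite subrr mulr0.
  rewrite -(rdiagD K (fun=> 1)) rdiag1 mulmxDr mulmx1 -rdiagN mulmxN => /eqP.
  by rewrite subr_eq0 => /eqP {2}->.
(* The inverse of [0] being [0], the columns of [Z] at zero angles vanish, in agreement with [E]. *)
pose Z := G *m rdiag (fun i : 'I_k => (sin (th i))^-1).
exists V, Z; last first.
  rewrite /Z -(mulmxA G) rdiagM.
  have -> : rdiag (fun i : 'I_k => (sin (th i))^-1 * sin (th i)) = E.
    apply: eq_rdiag => i; have := sin0 i.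
    by case: (th i == 0) => [/eqP ->|/negbT s0]; rewrite ?mulr0 // mulVf.
  by rewrite GE -/X' -/c /G addrC subrK.
split=> //; split=> //.
- by rewrite /Z mulmxA X'G mul0mx.
- rewrite /Z ctrM ctr_rdiag mulmxA -(mulmxA _ G^h) GG !rdiagM.
  apply: eq_rdiag => i; have := sin0 i.
  case: (th i == 0) => [/eqP ->|/negbT s0]; first by rewrite expr0n mulr0 mul0r.
  by rewrite expr2 mulrA mulVf // mul1r mulfV.
- rewrite /Z -(mulmxA G) rdiagM; congr (_ *m _).
  apply: eq_rdiag => i; have := sin0 i.
  by case: (th i == 0) => [/eqP ->|_]; rewrite ?invr0 ?mulr0 ?mulr1.
Qed.

End PrincipalFrame.

From mathcomp Require Import boolp classical_sets functions topology.
From mathcomp Require Import normedtype derive realfun.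
Import numFieldNormedType.Exports.
Local Open Scope classical_set_scope.

(** * Mean value inequalities and derivatives of bilinear forms *)

Section MeanValue.
Variable R : realType.

Lemma increment_le (f df : R -> R) (a b B : R) :
  a < b -> (forall t : R, is_derive t 1 f (df t)) ->
  (forall t, a < t < b -> df t <= B) -> f b - f a <= B * (b - a).
Proof.
move=> ab fd dfB.
have fc : {within `[a, b], continuous f}.
  apply/continuous_subspaceT => t.
  by apply/differentiable_continuous/derivable1_diffP; have [] := fd t.
have [c cab ->] := MVT ab (fun x _ => fd x) fc.
apply: ler_wpM2r; first by rewrite subr_ge0 ltW.
apply: dfB.
by move: cab; rewrite in_itv.
Qed.

(** The mean value inequality for [g] gives [g t <= 2 * B * t], so [f t - B * t ^+ 2] has
    non-positive derivative on the unit interval. *)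
Lemma increment_le2 (f g dg : R -> R) (B : R) :
  (forall t : R, is_derive t 1 f (g t)) -> (forall t : R, is_derive t 1 g (dg t)) ->
  g 0 = 0 -> (forall t, dg t <= 2 * B) -> f 1 - f 0 <= B.
Proof.
move=> fd gd g0 dgB.
have gB (t : R) : 0 < t -> g t <= 2 * B * t.
  move=> t0; have := increment_le t0 gd (fun s _ => dgB s).
  by rewrite g0 !subr0.
pose h t := f t - B * t ^+ 2.
have hd (t : R) : is_derive t 1 h (g t - B * (2 * t)).
  have -> : h = f - B *: ((id : R -> R) * id) by apply/funext.
  have did := is_derive_id t (1 : R).
  apply: (is_derive_eq (is_deriveB (fd t) (is_deriveZ B (is_deriveM did did)))).
  by rewrite /GRing.scale /=; ring.
have : h 1 - h 0 <= 0 * (1 - 0).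
  apply: (increment_le ltr01 hd) => t /andP[t0 _].
  by have := gB t t0; lra.
by rewrite mul0r /h expr1n expr0n mulr1 mulr0 subr0 => h1; lra.
Qed.

Lemma is_derive_bigsum (I : Type) (s : seq I) (h : I -> R -> R) (dh : I -> R) (t : R) :
  (forall i, is_derive t 1 (h i) (dh i)) ->
  is_derive t 1 (fun x => \sum_(i <- s) h i x) (\sum_(i <- s) dh i).
Proof.
move=> hd; elim: s => [|i s IH].
  rewrite big_nil; have -> : (fun x : R => \sum_(i <- [::]) h i x) = cst 0.
    by apply/funext => x; rewrite big_nil.
  exact: is_derive_cst.
rewrite big_cons.
have -> : (fun x : R => \sum_(j <- i :: s) h j x) =
    h i + (fun x => \sum_(j <- s) h j x).
  by apply/funext => x; rewrite big_cons.
exact: is_deriveD.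
Qed.

Lemma is_derive_bilinear (I : finType) (B : I -> I -> R) (u v : I -> R -> R)
    (du dv : I -> R) (t : R) :
  (forall i, is_derive t 1 (u i) (du i)) ->
  (forall i, is_derive t 1 (v i) (dv i)) ->
  is_derive t 1 (fun x => \sum_i \sum_j B i j * (u i x * v j x))
    (\sum_i \sum_j B i j * (du i * v j t) +
     \sum_i \sum_j B i j * (u i t * dv j)).
Proof.
move=> ud vd; rewrite -big_split; apply: is_derive_bigsum => i /=.
rewrite -big_split; apply: is_derive_bigsum => j /=.
have -> : (fun x => B i j * (u i x * v j x)) = B i j *: (u i * v j).
  by apply/funext.
apply: (is_derive_eq (is_deriveZ _ (is_deriveM (ud i) (vd j)))).
by rewrite /GRing.scale /=; ring.
Qed.

Lemma is_derive_cosM (a t : R) :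
  is_derive t 1 (fun x => cos (x * a)) (- (sin (t * a) * a)).
Proof.
have d : is_derive t 1 (fun x : R => x * a) a.
  have -> : (fun x : R => x * a) = a *: id by apply/funext => x; rewrite /= mulrC.
  apply: (is_derive_eq (is_deriveZ a (is_derive_id t 1))).
  by rewrite /GRing.scale /= mulr1.
have h := @is_derive1_comp _ cos (fun x => x * a) t _ _ (is_derive_cos (t * a)) d.
by apply: (is_derive_eq h); rewrite mulNr.
Qed.

Lemma is_derive_sinM (a t : R) :
  is_derive t 1 (fun x => sin (x * a)) (cos (t * a) * a).
Proof.
have d : is_derive t 1 (fun x : R => x * a) a.
  have -> : (fun x : R => x * a) = a *: id by apply/funext => x; rewrite /= mulrC.
  apply: (is_derive_eq (is_deriveZ a (is_derive_id t 1))).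
  by rewrite /GRing.scale /= mulr1.
exact: (@is_derive1_comp _ sin (fun x => x * a) t _ _ (is_derive_sin (t * a)) d).
Qed.

End MeanValue.

(** * The rotating frame and its derivatives *)

Section Path.
Variables (R : realType) (C : numClosedFieldType) (K : real_part R C).
Local Notation emb := (emb K).
Local Notation rtr := (rtr K).
Local Notation rdiag := (rdiag K).

Section Curve.
Variables (d k : nat) (X Z : 'M[C]_(d, k)) (W : 'M[C]_k) (A : 'M[C]_d).

Definition curve (a b : 'I_k -> R) : 'M[C]_(d, k) :=
  X *m rdiag a + Z *m rdiag b.

(** A curve is a real combination of fixed matrices, so the trace is a real bilinear form in the
    coefficients. Independent coefficients on the two sides cover both the function and its
    derivative. *)
Lemma is_derive_curve (a b a2 b2 : 'I_k -> R -> R) (da db da2 db2 : 'I_k -> R) (t : R) :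
  (forall i, is_derive t 1 (a i) (da i)) ->
  (forall i, is_derive t 1 (b i) (db i)) ->
  (forall i, is_derive t 1 (a2 i) (da2 i)) ->
  (forall i, is_derive t 1 (b2 i) (db2 i)) ->
  is_derive t 1
    (fun x => rtr (W *m ((curve (a^~ x) (b^~ x))^h *m A *m curve (a2^~ x) (b2^~ x))))
    (rtr (W *m ((curve da db)^h *m A *m curve (a2^~ t) (b2^~ t))) +
     rtr (W *m ((curve (a^~ t) (b^~ t))^h *m A *m curve da2 db2))).
Proof.
move=> ad bd a2d b2d.
pose G (l : 'I_k + 'I_k) : 'M[C]_(d, k) :=
  match l with inl j => X *m delta_mx j j | inr j => Z *m delta_mx j j end.
(* Polymorphic in [T], as it collects both values and functions of time. *)
pose cf T (a b : 'I_k -> T) (l : 'I_k + 'I_k) :=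
  match l with inl j => a j | inr j => b j end.
have curveE u v : curve u v = \sum_l emb (cf R u v l) *: G l.
  have diagE w : rdiag w = \sum_j emb (w j) *: delta_mx j j.
    apply/matrixP => p q; rewrite rdiagE summxE (bigD1 p) //= big1 => [|j jp].
      by rewrite !mxE eqxx addr0 /= eq_sym mulr_natr.
    by rewrite !mxE eq_sym (negbTE jp) mulr0.
  rewrite big_sumType /= /curve !diagE !mulmx_sumr.
  by congr (_ + _); apply: eq_bigr => j _; rewrite -scalemxAr.
pose B l m := rtr (W *m ((G l)^h *m A *m G m)).
have bilE u v u2 v2 : rtr (W *m ((curve u v)^h *m A *m curve u2 v2)) =
    \sum_l \sum_m B l m * (cf R u v l * cf R u2 v2 m).
  rewrite !curveE mulmx_sumr mulmx_sumr rtr_sum exchange_big /=.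
  apply: eq_bigr => m _.
  have -> : (\sum_l emb (cf R u v l) *: G l)^h =
      \sum_l emb (cf R u v l) *: (G l)^h.
    have ctr_sum (F : 'I_k + 'I_k -> 'M[C]_(d, k)) : (\sum_l F l)^h = \sum_l (F l)^h.
      by apply: (big_morph (@ctr C d k) (@ctrD C d k) (@ctr0 C d k)).
    rewrite ctr_sum; apply: eq_bigr => l _; apply/matrixP => p q.
    by rewrite ctrE !mxE rmorphM /= conj_emb.
  rewrite -scalemxAr -scalemxAr rtrZ !mulmx_suml mulmx_sumr rtr_sum mulr_sumr.
  apply: eq_bigr => l _.
  by rewrite -!scalemxAl -scalemxAr rtrZ /B; ring.
have -> : (fun x => rtr (W *m ((curve (a^~ x) (b^~ x))^h *m A *m
      curve (a2^~ x) (b2^~ x)))) =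
    (fun x => \sum_l \sum_m B l m * (cf _ a b l x * cf _ a2 b2 m x)).
  apply/funext => x; rewrite bilE; apply: eq_bigr => l _; apply: eq_bigr => m _.
  by case: l m => l [] m.
rewrite !bilE.
have e1 l : cf R (a^~ t) (b^~ t) l = cf _ a b l t by case: l.
have e2 l : cf R (a2^~ t) (b2^~ t) l = cf _ a2 b2 l t by case: l.
under eq_bigr do under eq_bigr do rewrite e2.
under [X in _ + X]eq_bigr do under eq_bigr do rewrite e1.
by apply: is_derive_bilinear => -[].
Qed.

End Curve.

Variables (d k : nat) (X Z : 'M[C]_(d, k)) (th : nat -> R).
Local Notation T := (rdiag (fun i : 'I_k => th i)).
Local Notation E := (rdiag (fun i : 'I_k => (th i != 0)%:R)).
Hypothesis F : frame X Z E.

Let c (t : R) : 'I_k -> R := fun i => cos (t * th i).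
Let s (t : R) : 'I_k -> R := fun i => sin (t * th i).

Definition moving_X t := curve X Z (c t) (s t).
Definition moving_Z t := curve X Z (fun i => - s t i) (c t).

Let sE t : rdiag (s t) *m E = rdiag (s t).
Proof.
rewrite rdiagM; apply: eq_rdiag => i; rewrite /s.
by have [->|_] := eqVneq (th i) 0; rewrite ?mulr1 // !mulr0 ?sin0 ?mul0r.
Qed.

Let curve_gram a b a2 b2 :
  (curve X Z a b)^h *m curve X Z a2 b2 =
  rdiag a *m rdiag a2 + rdiag b *m E *m rdiag b2.
Proof.
rewrite /curve ctrD !ctrM !ctr_rdiag mulmxDl !mulmxDr !mulmxA.
rewrite -!(mulmxA _ X^h) -!(mulmxA _ Z^h) (frame_XX F) (frame_XZ F).
by rewrite (frame_ZX F) (frame_ZZ F) mulmx1 !mulmx0 !mul0mx addr0 add0r.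
Qed.

(** Each pair of columns of [X] and [Z] is rotated; at a zero angle nothing moves, so a zero column
    of [Z] stays zero. *)
Lemma moving_frame t : frame (moving_X t) (moving_Z t) E.
Proof.
split; rewrite ?curve_gram ?sE.
- rewrite !rdiagM rdiagD -(rdiag1 K); apply: eq_rdiag => i.
  by rewrite -!expr2 cos2Dsin2.
- rewrite !rdiagM rdiagD -(rdiag0 K); apply: eq_rdiag => i /=.
  by rewrite mulrN [s t i * _]mulrC addNr.
- rewrite !rdiagM rdiagD; apply: eq_rdiag => i; rewrite /c /s.
  have [->|_] := eqVneq (th i) 0; first by rewrite /= !(mulr0, mul0r, sin0, oppr0, addr0).
  by rewrite mulr1 mulrNN -!expr2 addrC cos2Dsin2.
- rewrite /moving_Z /curve mulmxDl -!mulmxA -rdiagN mulNmx sE.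
  by rewrite rdiagC mulmxA (frame_ZE F).
Qed.

Lemma moving_X0 : moving_X 0 = X.
Proof.
rewrite /moving_X /curve.
have -> : rdiag (c 0) = 1%:M.
  by rewrite -(rdiag1 K); apply: eq_rdiag => i; rewrite /c mul0r cos0.
have -> : rdiag (s 0) = 0.
  by rewrite -(rdiag0 K k); apply: eq_rdiag => i; rewrite /s mul0r sin0.
by rewrite mulmx1 mulmx0 addr0.
Qed.

Lemma moving_Z0 : moving_Z 0 = Z.
Proof.
rewrite /moving_Z /curve.
have -> : rdiag (c 0) = 1%:M.
  by rewrite -(rdiag1 K); apply: eq_rdiag => i; rewrite /c mul0r cos0.
have -> : rdiag (fun i => - s 0 i) = 0.
  by rewrite -(rdiag0 K k); apply: eq_rdiag => i; rewrite /s mul0r sin0 oppr0.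
by rewrite mulmx1 mulmx0 add0r.
Qed.

Lemma moving_X1 : moving_X 1 = X *m rdiag (fun i : 'I_k => cos (th i)) +
  Z *m rdiag (fun i : 'I_k => sin (th i)).
Proof.
by rewrite /moving_X /curve; congr (_ + _); congr (_ *m _); apply: eq_rdiag => i;
  rewrite /c /s mul1r.
Qed.

(** The right-hand side has as coefficients the time derivatives of those of [moving_X];
    [moving_XTT] does the same for [moving_Z t *m T]. *)
Let moving_ZT t : moving_Z t *m T =
  curve X Z (fun i => - (sin (t * th i) * th i)) (fun i => cos (t * th i) * th i).
Proof.
rewrite /moving_Z /curve mulmxDl -!mulmxA !rdiagM.
by congr (_ + _); congr (_ *m _); apply: eq_rdiag => i; rewrite mulNr.
Qed.

Let moving_XTT t : - (moving_X t *m T *m T) =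
  curve X Z (fun i => - (cos (t * th i) * th i * th i))
    (fun i => - (sin (t * th i) * th i * th i)).
Proof.
rewrite /moving_X /curve !mulmxDl -!mulmxA !rdiagM opprD -!mulmxN !rdiagN.
by congr (_ + _); congr (_ *m _); apply: eq_rdiag => i; rewrite mulrA.
Qed.

Variables (W : 'M[C]_k) (A : 'M[C]_d).
Hypotheses (Wh : W^h = W) (Ah : A^h = A).

Let rtr_swap (G H : 'M[C]_(d, k)) :
  rtr (W *m (G^h *m A *m H)) = rtr (W *m (H^h *m A *m G)).
Proof.
by rewrite -rtr_ctr !ctrM ctrK Wh Ah rtr_mulC !mulmxA.
Qed.

Lemma is_derive_ritz (t : R) :
  is_derive t 1
    (fun t => rtr (W *m ((moving_X t)^h *m A *m moving_X t)))
    (2 * rtr (W *m ((moving_X t)^h *m A *m moving_Z t) *m T)).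
Proof.
have dc (i : 'I_k) : is_derive t 1 (fun t => c t i) (- (sin (t * th i) * th i)).
  exact: is_derive_cosM.
have ds (i : 'I_k) : is_derive t 1 (fun t => s t i) (cos (t * th i) * th i).
  exact: is_derive_sinM.
apply: (is_derive_eq (is_derive_curve X Z W A
  (a := fun (i : 'I_k) (t : R) => c t i)
  (b := fun (i : 'I_k) (t : R) => s t i)
  (a2 := fun (i : 'I_k) (t : R) => c t i)
  (b2 := fun (i : 'I_k) (t : R) => s t i)
  dc ds dc ds)).
(* The two terms of the product rule coincide because [W] and [A] are Hermitian, whence the factor
   2. *)
rewrite -moving_ZT rtr_swap -!mulmxA -/(moving_X t) mulrDl mul1r.
by rewrite !mulmxA.
Qed.

Lemma is_derive_ritz2 (t : R) :
  is_derive t 1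
    (fun t => rtr (W *m ((moving_X t)^h *m A *m moving_Z t) *m T))
    (rtr (W *m (T *m ((moving_Z t)^h *m A *m moving_Z t) -
                (moving_X t)^h *m A *m moving_X t *m T) *m T)).
Proof.
have dc (i : 'I_k) : is_derive t 1 (fun t => c t i) (- (sin (t * th i) * th i)).
  exact: is_derive_cosM.
have ds (i : 'I_k) : is_derive t 1 (fun t => s t i) (cos (t * th i) * th i).
  exact: is_derive_sinM.
have dc2 (i : 'I_k) : is_derive t 1 (fun t : R => - (sin (t * th i) * th i))
    (- (cos (t * th i) * th i * th i)).
  have -> : (fun t : R => - (sin (t * th i) * th i)) =
      - (th i *: (fun t => s t i)) by apply/funext => x; rewrite /= mulrC.
  apply: (is_derive_eq (is_deriveN (is_deriveZ (th i) (ds i)))).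
  by rewrite /GRing.scale /= [th i * _]mulrC.
have ds2 (i : 'I_k) : is_derive t 1 (fun t : R => cos (t * th i) * th i)
    (- (sin (t * th i) * th i * th i)).
  have -> : (fun t : R => cos (t * th i) * th i) =
      th i *: (fun t => c t i) by apply/funext => x; rewrite /= mulrC.
  apply: (is_derive_eq (is_deriveZ (th i) (dc i))).
  by rewrite /GRing.scale /=; ring.
have -> : (fun t : R => rtr (W *m ((moving_X t)^h *m A *m moving_Z t) *m T)) =
    (fun t => rtr (W *m ((curve X Z (c t) (s t))^h *m A *m
      curve X Z (fun i => - (sin (t * th i) * th i)) (fun i => cos (t * th i) * th i)))).
  by apply/funext => x; rewrite -moving_ZT -!mulmxA.
apply: (is_derive_eq (is_derive_curve X Z W A
  (a := fun (i : 'I_k) (t : R) => c t i)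
  (b := fun (i : 'I_k) (t : R) => s t i)
  (a2 := fun (i : 'I_k) (t : R) => - (sin (t * th i) * th i))
  (b2 := fun (i : 'I_k) (t : R) => cos (t * th i) * th i)
  dc ds dc2 ds2)).
rewrite -moving_ZT -moving_XTT -/(moving_X t).
rewrite mulmxBr mulmxBl rtrB mulmxN mulmxN rtrN.
by rewrite ctrM ctr_rdiag !mulmxA.
Qed.

End Path.

(** * Bounding the derivatives by the spectral spread *)

Section RitzBounds.
Variables (R : realType) (C : numClosedFieldType) (K : real_part R C).
Local Notation rtr := (rtr K).
Local Notation contractive := (contractive K).
Local Notation rdiag := (rdiag K).

Lemma sum_trunc_le k m (F : nat -> R) : (forall i, 0 <= F i) ->
  \sum_(i < k) (i < m)%:R * F i <= \sum_(i < m) F i.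
Proof.
move=> F0; case: (leqP m k) => mk; first by rewrite sum_ord_lt.
apply: le_trans (_ : \sum_(i < k) F i <= _).
  by apply: ler_sum => i _; case: (i < m)%N; rewrite ?mul1r ?mul0r.
rewrite -(sum_ord_lt F (ltnW mk)); apply: ler_sum => i _.
by case: (i < k)%N; rewrite ?mul1r ?mul0r.
Qed.

Section Derivatives.
Variables (d k : nat) (X Z : 'M[C]_(d, k)) (th : nat -> R) (W : 'M[C]_k) (r : nat).
Local Notation T := (rdiag (fun i : 'I_k => th i)).
Hypothesis F : frame X Z (rdiag (fun i : 'I_k => (th i != 0)%:R)).
Hypothesis W_contractive : contractive W.
Hypothesis rtr_W : forall G, contractive G -> rtr (W *m G) <= r%:R.
Hypothesis thS : forall i, th i.+1 <= th i.
Hypothesis th0 : forall i, 0 <= th i.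
Variables (Ua : 'M[C]_d) (lam : nat -> R).
Hypothesis Uu : Ua^h *m Ua = 1%:M.
Hypothesis lamS : forall i, (i.+1 < d)%N -> lam i.+1 <= lam i.
Let A := Ua *m rdiag (fun i : 'I_d => lam i) *m Ua^h.

Let UU : Ua^h^h *m Ua^h = 1%:M.
Proof. by rewrite ctrK; apply: mulmx1C. Qed.

Let spectral_projection (J : pred 'I_d) :
  let P := Ua^h^h *m rdiag (fun i => (J i)%:R) *m Ua^h in
  [/\ P^h = P, P *m P = P & rtr P = #|J|%:R].
Proof.
rewrite ctrK /=; split.
- by rewrite !ctrM ctrK ctr_rdiag mulmxA.
- rewrite !mulmxA -(mulmxA _ Ua^h Ua) Uu mulmx1 -(mulmxA Ua) rdiagM.
  by congr (_ *m _ *m _); apply: eq_rdiag => i; case: (J i); rewrite ?mulr1 ?mulr0.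
- rewrite rtr_mulC mulmxA Uu mul1mx rtr_rdiag -sum1_card natr_sum [RHS]big_mkcond.
  by apply: eq_bigr => i _; rewrite /in_mem /=; case: (J i).
Qed.

Let NW_contractive : contractive (- W).
Proof. exact: contractiveN. Qed.

Let rtr_NW G : contractive G -> rtr (- W *m G) <= r%:R.
Proof. by move=> hG; rewrite mulNmx -mulmxN; apply: rtr_W; apply: contractiveN. Qed.

(** [spread_bound] for the trace as a functional of [A], with [offdiag_bound] giving its values at
    spectral projections; lower bounds follow by using [- W]. *)
Lemma first_derivative_bound :
  2 * rtr (W *m (X^h *m A *m Z) *m T) <=
    \sum_(j < d./2) th j * (j < r)%:R * (lam j - lam (d - j.+1)%N).
Proof.
pose phi B := 2 * rtr (W *m (X^h *m B *m Z) *m T).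
rewrite -/(phi A) /A -{1}[Ua]ctrK.
apply: (spread_bound (phi := phi) (tau := fun j => th j * (j < r)%:R)) => //.
- by move=> B D; rewrite /phi mulmxDr mulmxDl mulmxDr mulmxDl rtrD mulrDr.
- move=> a B; rewrite /phi -scalemxAr -scalemxAl -scalemxAr -scalemxAl rtrZ.
  by rewrite mulrCA.
- by rewrite /phi mulmx1 (frame_XZ F) mulmx0 mul0mx rtr0 mulr0.
move=> J; have [Ph PP Pm] := spectral_projection J.
set P := _ *m _ *m _ in Ph PP Pm *.
(* One bound sums over the [k] angles, the other over [#|J|] terms; any extra terms are
   non-negative. *)
have bound : \sum_(i < k) th i * (i < minn #|J| r)%:R <=
    \sum_(j < #|J|) th j * (j < r)%:R.
  apply: le_trans (sum_trunc_le k #|J| (F := fun j => th j * (j < r)%:R) _).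
    by apply: ler_sum => i _; rewrite leq_min -mulnb natrM mulrCA.
  by move=> i; rewrite mulr_ge0.
rewrite ler_norml; apply/andP; split; last first.
  apply: le_trans bound.
  exact: (offdiag_bound F W_contractive rtr_W Ph PP Pm thS th0).
rewrite lerNl; apply: le_trans bound.
have := offdiag_bound F NW_contractive rtr_NW Ph PP Pm thS th0.
by rewrite /phi !mulNmx rtrN mulrN.
Qed.

Lemma second_derivative_bound :
  rtr (W *m (T *m (Z^h *m A *m Z) - X^h *m A *m X *m T) *m T) <=
    \sum_(j < d./2) th j ^+ 2 * (j < r)%:R * (lam j - lam (d - j.+1)%N).
Proof.
pose phi B := rtr (W *m (T *m (Z^h *m B *m Z) - X^h *m B *m X *m T) *m T).
rewrite -/(phi A) /A -{1}[Ua]ctrK.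
have phiE B : phi B = rtr (W *m (T *m (Z^h *m B *m Z)) *m T) -
    rtr (W *m (X^h *m B *m X *m T) *m T).
  by rewrite /phi mulmxBr mulmxBl rtrB.
apply: (spread_bound (phi := phi) (tau := fun j => th j ^+ 2 * (j < r)%:R)) => //.
- by move=> B D; rewrite !phiE !(mulmxDr, mulmxDl) !rtrD; ring.
- move=> a B; rewrite !phiE -!(scalemxAr, scalemxAl) !rtrZ mulrBr.
  by congr (_ - _); rewrite -?scalemxAr -?scalemxAl ?rtrZ.
(* At the identity the difference is [T *m E - T], and [E] is one wherever the angle is nonzero. *)
- rewrite /phi !mulmx1 (frame_XX F) (frame_ZZ F) mul1mx.
  have -> : T *m rdiag (fun i : 'I_k => (th i != 0)%:R) = T.
    rewrite rdiagM; apply: eq_rdiag => i.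
    by have [->|_] := eqVneq (th i) 0; rewrite ?mul0r ?mulr1.
  by rewrite subrr mulmx0 mul0mx rtr0.
move=> J; have [Ph PP Pm] := spectral_projection J.
set P := _ *m _ *m _ in Ph PP Pm *.
have bound : \sum_(i < k) th i * (th i * (i < minn #|J| r)%:R) <=
    \sum_(j < #|J|) th j ^+ 2 * (j < r)%:R.
  apply: le_trans (sum_trunc_le k #|J| (F := fun j => th j ^+ 2 * (j < r)%:R) _).
    by apply: ler_sum => i _; rewrite leq_min -mulnb natrM mulrA -expr2 mulrCA.
  by move=> i; rewrite mulr_ge0 ?sqr_ge0.
rewrite ler_norml; apply/andP; split; last first.
  apply: le_trans bound.
  exact: (diag_bound F W_contractive rtr_W Ph PP Pm thS th0).
rewrite lerNl; apply: le_trans bound.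
have := diag_bound F NW_contractive rtr_NW Ph PP Pm thS th0.
by rewrite /phi !mulNmx rtrN.
Qed.

End Derivatives.

(** * Integrating along the path from [X] to [Y] *)

Section Main.
Variables (d k : nat) (A Ua : 'M[C]_d) (X Y : 'M[C]_(d, k)) (U1 U2 U : 'M[C]_k).
Variables (lam p q th : nat -> R).
Hypothesis Xi : X^h *m X = 1%:M.
Hypothesis Yi : Y^h *m Y = 1%:M.
Hypothesis Uau : Ua^h *m Ua = 1%:M.
Hypothesis U1u : U1^h *m U1 = 1%:M.
Hypothesis U2u : U2^h *m U2 = 1%:M.
Hypothesis Uu : U^h *m U = 1%:M.
Hypothesis lamS : forall i, (i.+1 < d)%N -> lam i.+1 <= lam i.
Hypothesis pS : forall i, (i.+1 < k)%N -> p i.+1 <= p i.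
Hypothesis qS : forall i, (i.+1 < k)%N -> q i.+1 <= q i.
Hypothesis AE : A = Ua *m rdiag (fun i : 'I_d => lam i) *m Ua^h.
Hypothesis PE : X^h *m A *m X = U1 *m rdiag (fun i : 'I_k => p i) *m U1^h.
Hypothesis QE : Y^h *m A *m Y = U2 *m rdiag (fun i : 'I_k => q i) *m U2^h.
Hypothesis angE : (X^h *m Y)^h *m (X^h *m Y) =
  U *m rdiag (fun i : 'I_k => cos (th i) ^+ 2) *m U^h.
Hypothesis thS : forall i, th i.+1 <= th i.
Hypothesis th0 : forall i, 0 <= th i.
Hypothesis sin_th : forall i : 'I_k, (sin (th i) == 0) = (th i == 0).

Let Ah : A^h = A.
Proof. by rewrite AE !ctrM ctrK ctr_rdiag mulmxA. Qed.

Let compression (S : 'M[C]_(d, k)) (V1 V : 'M[C]_k) (a : nat -> R) :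
  V^h *m V = 1%:M -> V1^h *m V1 = 1%:M ->
  S^h *m A *m S = V1 *m rdiag (fun i : 'I_k => a i) *m V1^h ->
  (V^h *m V1)^h *m (V^h *m V1) = 1%:M /\
  (S *m V)^h *m A *m (S *m V) =
    (V^h *m V1) *m rdiag (fun i : 'I_k => a i) *m (V^h *m V1)^h.
Proof.
move=> Vu V1u SE; have VV : V *m V^h = 1%:M by apply: mulmx1C.
rewrite !ctrM ctrK; split.
  by rewrite mulmxA -(mulmxA _ V) VV mulmx1.
by rewrite -!mulmxA (mulmxA A) (mulmxA S^h) (mulmxA S^h) SE !mulmxA.
Qed.

(** [mirsky] is applied to the compressions written in principal vectors. The rotation starts at
    [X V] and ends at [Y U], so the resulting trace is an increment along the path. *)
Lemma ritz_path (I : pred 'I_k) :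
  exists W : 'M[C]_k, exists V : 'M[C]_k, exists Z : 'M[C]_(d, k),
  [/\ W^h = W, contractive W,
      forall G, contractive G -> rtr (W *m G) <= #|I|%:R,
      V^h *m V = 1%:M & frame (X *m V) Z (rdiag (fun i : 'I_k => (th i != 0)%:R))] /\
  \sum_(i < k | I i) `|p i - q i| <=
    rtr (W *m ((moving_X K (X *m V) Z th 1)^h *m A *m moving_X K (X *m V) Z th 1)) -
    rtr (W *m ((moving_X K (X *m V) Z th 0)^h *m A *m moving_X K (X *m V) Z th 0)).
Proof.
have [V [Z [Vu F] YE]] := principal_frame Xi Yi Uu angE sin_th.
have [VU1 PE'] := compression Vu U1u PE.
have [UU2 QE'] := compression Uu U2u QE.
have [Om [eps [Omu eps3 eps2 hI]]] := mirsky I VU1 UU2 pS qS PE' QE'.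
exists (Om *m rdiag eps *m Om^h), V, Z; split.
  split=> //.
  - by rewrite !ctrM ctrK ctr_rdiag mulmxA.
  - exact: contractive_conj_sign.
  - by move=> G hG; rewrite -eps2; apply: rtr_conj_sign_le.
apply: le_trans hI _; rewrite moving_X1 moving_X0 -YE.
by rewrite rtr_mulC mulmxBr rtrB.
Qed.

Lemma ritz_bound (I : pred 'I_k) :
  \sum_(i < k | I i) `|p i - q i| <=
  \sum_(j < d./2) th j * (j < #|I|)%:R * (lam j - lam (d - j.+1)%N).
Proof.
have [W [V [Z [[Wh cW rW Vu F] hI]]]] := ritz_path I; apply: le_trans hI _.
set B := \sum_(j < _) _.
have := increment_le (B := B) ltr01 (fun t => is_derive_ritz K (X *m V) Z th Wh Ah t).
rewrite subr0 mulr1; apply => t _.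
have Ft := moving_frame F t.
by rewrite AE; apply: first_derivative_bound Ft cW rW thS th0 _ _ Uau lamS.
Qed.

Lemma ritz_bound_invariant (I : pred 'I_k) (B : 'M[C]_k) :
  A *m X = X *m B ->
  \sum_(i < k | I i) `|p i - q i| <=
  \sum_(j < d./2) th j ^+ 2 * (j < #|I|)%:R * (lam j - lam (d - j.+1)%N).
Proof.
move=> AX; have [W [V [Z [[Wh cW rW Vu F] hI]]]] := ritz_path I.
apply: le_trans hI _.
have dg t := is_deriveZ 2 (is_derive_ritz2 K (X *m V) Z th W A t).
apply: (increment_le2 (fun t => is_derive_ritz K (X *m V) Z th Wh Ah t) dg).
(* The first derivative vanishes at the start: [Z^h A X = Z^h X B = 0]. *)
- rewrite moving_X0 moving_Z0.
  have VV : V *m V^h = 1%:M by apply: mulmx1C.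
  have ZX : Z^h *m X = 0.
    by rewrite -[X]mulmx1 -VV (mulmxA X) mulmxA (frame_ZX F) mul0mx.
  have -> : (X *m V)^h *m A *m Z = 0.
    have e : ((X *m V)^h *m A *m Z)^h = 0.
      by rewrite !ctrM !ctrK Ah !mulmxA -(mulmxA _ A X) AX !mulmxA ZX !mul0mx.
    by rewrite -[LHS]ctrK e ctr0.
  by rewrite mulmx0 mul0mx rtr0 mulr0.
- move=> t; rewrite ler_pM2l ?ltr0n //.
  have Ft := moving_frame F t.
  by rewrite AE; apply: second_derivative_bound Ft cW rW thS th0 _ _ Uau lamS.
Qed.

End Main.
End RitzBounds.

(** * Complex numbers, lists of eigenvalues and angles, submajorization *)

Section Concrete.
Variable R : realType.
Local Notation C := R[i].

Lemma complex_reD (x y : C) : complex.Re (x + y) = complex.Re x + complex.Re y.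
Proof. by case: x y => [a b] [c e]. Qed.

Lemma complex_re_embM (a : R) (x : C) :
  complex.Re (real_complex R a * x) = a * complex.Re x.
Proof. by case: x => b c /=; rewrite mul0r subr0. Qed.

Lemma complex_re_conj (x : C) : complex.Re (Num.conj x) = complex.Re x.
Proof. by case: x. Qed.

Lemma complex_conj_emb (a : R) : Num.conj (real_complex R a : C) = real_complex R a.
Proof. by rewrite /Num.conj /= oppr0. Qed.

Lemma complex_re_sqr_ge0 (x : C) : 0 <= complex.Re (Num.conj x * x).
Proof. by case: x => a b /=; rewrite mulNr opprK addr_ge0 // -expr2 sqr_ge0. Qed.

Lemma complex_re_sqr_eq0 (x : C) : complex.Re (Num.conj x * x) = 0 -> x = 0.
Proof.
case: x => a b /= /eqP; rewrite mulNr opprK -!expr2 paddr_eq0 ?sqr_ge0 //.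
by rewrite !sqrf_eq0 => /andP[/eqP -> /eqP ->].
Qed.

Lemma complex_emb_re (x : C) : x \is Num.real -> real_complex R (complex.Re x) = x.
Proof. exact: RRe_real. Qed.

Definition complex_real_part : real_part R C :=
  @RealPart R C (@complex.Re R) (real_complex R) complex_reD complex_re_embM
    erefl complex_re_conj complex_conj_emb complex_re_sqr_ge0 complex_re_sqr_eq0
    complex_emb_re.
Local Notation K := complex_real_part.

Lemma eigvals_spectral n (M : 'M[C]_n) (s : seq R) : M^h = M ->
  perm_eq s (eigvals M) ->
  exists2 U : 'M[C]_n, U^h *m U = 1%:M &
    M = U *m rdiag K (fun i : 'I_n => s`_i) *m U^h.
Proof.
move=> /hermsymmxP Mh sM; apply: spectral_perm => //.
by apply: perm_trans sM _; rewrite perm_sort.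
Qed.

Lemma size_eigvals n (M : 'M[C]_n) : size (eigvals M) = n.
Proof. by rewrite size_sort size_map size_enum_ord. Qed.

Lemma eigvals_sorted n (M : 'M[C]_n) i :
  (i.+1 < n)%N -> (eigvals M)`_i.+1 <= (eigvals M)`_i.
Proof. by move=> hi; apply: sort_dec_sorted; rewrite size_map size_enum_ord. Qed.

(** The test matrix [x], whose only nonzero column is the [i]-th eigenvector, has norm one, and
    [M *m x] has squared norm [s i]. *)
Lemma contractive_gram_eigenvalue k (M U : 'M[C]_k) (s : 'I_k -> R) i :
  contractive K M -> U^h *m U = 1%:M ->
  M^h *m M = U *m rdiag K s *m U^h -> 0 <= s i <= 1.
Proof.
move=> cM Uu MM.
pose x := U *m rdiag K (fun j => (j == i)%:R).
have sumd (f : 'I_k -> R) : \sum_j (j == i)%:R * f j = f i.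
  rewrite (bigD1 i) //= eqxx mul1r big1 ?addr0 // => j /negbTE ->.
  by rewrite mul0r.
have xx : ip K x x = 1.
  rewrite ipE ctrM ctr_rdiag mulmxA -(mulmxA _ U^h) Uu mulmx1 rdiagM rtr_rdiag.
  by rewrite (sumd (fun j => (j == i)%:R)) eqxx.
have Mx : ip K (M *m x) (M *m x) = s i.
  rewrite ip_mull mulmxA MM ipE ctrM ctr_rdiag !mulmxA.
  rewrite -(mulmxA _ U^h U) Uu mulmx1 -(mulmxA _ U^h U) Uu mulmx1 !rdiagM rtr_rdiag.
  under eq_bigr do rewrite -mulrA.
  by rewrite (sumd (fun j => s j * (j == i)%:R)) eqxx mulr1.
by rewrite -Mx ip_ge0 -xx; move/contractiveP: cM; apply.
Qed.

Lemma angles_spectral d k (X Y : 'M[C]_(d, k)) (th := nth 0 (angles X Y)) :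
  X^h *m X = 1%:M -> Y^h *m Y = 1%:M ->
  [/\ exists2 U : 'M[C]_k, U^h *m U = 1%:M &
        (X^h *m Y)^h *m (X^h *m Y) =
          U *m rdiag K (fun i : 'I_k => cos (th i) ^+ 2) *m U^h,
      forall i, th i.+1 <= th i, forall i, 0 <= th i &
      forall i : 'I_k, (sin (th i) == 0) = (th i == 0)].
Proof.
move=> Xi Yi; set M := X^h *m Y.
(* In reversed, non-decreasing order the eigenvalues match the non-increasing angles. *)
set s := rev (eigvals (M^h *m M)).
have size_s : size s = k by rewrite size_rev size_eigvals.
have MMh : (M^h *m M)^h = M^h *m M by rewrite ctrM ctrK.
have [U Uu ME] := eigvals_spectral MMh (permEl (perm_rev (eigvals (M^h *m M)))).
have cM : contractive K M.
  apply: contractiveM; last exact: isometry_contractive.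
  by apply: contractive_ctr; apply: isometry_contractive.
have s01 (i : nat) : (i < k)%N -> 0 <= s`_i <= 1.
  by move=> ik; apply: (contractive_gram_eigenvalue (Ordinal ik) cM Uu ME).
have size_th : size (angles X Y) = k.
  by rewrite size_rev !size_map size_eigvals.
have thE (i : nat) : (i < k)%N -> th i = acos (Num.sqrt s`_i).
  move=> ik; rewrite /th /angles /svals -!map_rev -map_comp.
  by rewrite (nth_map 0) ?size_s.
(* The default value [0] past [k] keeps the sequence non-increasing and non-negative. *)
have th_out (i : nat) : (k <= i)%N -> th i = 0.
  by move=> ki; rewrite /th nth_default // size_th.
have sq01 (i : nat) : (i < k)%N -> 0 <= Num.sqrt s`_i <= 1.
  move=> /s01/andP[h0 h1]; rewrite sqrtr_ge0 /= -[leRHS]sqrtr1.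
  exact: ler_wsqrtr.
have sq11 (i : nat) : (i < k)%N -> -1 <= Num.sqrt s`_i <= 1.
  by move=> /sq01/andP[h0 h1]; rewrite h1 andbT (le_trans _ h0) // lerN10.
have th0 i : 0 <= th i.
  by case: (ltnP i k) => ik; [rewrite thE ?acos_ge0 ?sq11|rewrite th_out].
split=> //.
- exists U; first exact: Uu.
  rewrite ME; suff -> : rdiag K (fun i : 'I_k => s`_i) =
    rdiag K (fun i : 'I_k => cos (th i) ^+ 2) by [].
  apply: eq_rdiag => i; rewrite thE // acosK ?in_itv /= ?sq11 // sqr_sqrtr //.
  by have /andP[] := s01 i (ltn_ord i).
- move=> i; case: (ltnP i.+1 k) => ik; last by rewrite th_out.
  have ik' : (i < k)%N by apply: ltnW.
  rewrite !thE // leNgt; apply/negP => lt_acos.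
  have : cos (acos (Num.sqrt s`_i.+1)) < cos (acos (Num.sqrt s`_i)).
    by rewrite ltr_cos ?in_itv //= ?acos_ge0 ?acos_lepi ?sq11.
  rewrite !acosK ?in_itv /= ?sq11 // ltNge ler_wsqrtr //.
  rewrite /s !nth_rev ?size_eigvals // -(subnSK ik).
  by apply: eigvals_sorted; lia.
(* For a cosine [x] in the unit interval the sine vanishes only at [x = 1], where the angle is
   [0]. *)
- move=> i; rewrite thE // sin_acos ?sq11 //.
  have /andP[h0 h1] := sq01 i (ltn_ord i).
  apply/eqP/eqP => [/eqP|h].
    rewrite sqrtr_eq0 subr_le0 => h2.
    have -> : Num.sqrt s`_i = 1 by apply/eqP; rewrite eq_le h1 -(expr_ge1 (n := 2)).
    exact: acos1.
  have : cos (acos (Num.sqrt s`_i)) = 1 by rewrite h cos0.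
  by rewrite acosK ?in_itv /= ?sq11 // => ->; rewrite expr1n subrr sqrtr0.
Qed.

Lemma nth_pad n (s : seq R) i : (pad n s)`_i = s`_i.
Proof.
rewrite nth_cat; case: ltnP => // si.
by rewrite nth_nseq if_same nth_default.
Qed.

Lemma size_pad n (s : seq R) : (size s <= n)%N -> size (pad n s) = n.
Proof. by move=> sn; rewrite size_cat size_nseq subnKC. Qed.

Lemma nth_mulv (x y : seq R) i : (mulv x y)`_i = x`_i * y`_i.
Proof.
rewrite /mulv; set n := maxn _ _.
have sx : size (pad n x) = n by rewrite size_pad ?leq_maxl.
have sy : size (pad n y) = n by rewrite size_pad ?leq_maxr.
case: (ltnP i n) => ni.
  rewrite (nth_map (0, 0)) ?size_zip ?sx ?sy ?minnn //.
  by rewrite nth_zip ?sx ?sy //= !nth_pad.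
rewrite nth_default ?size_map ?size_zip ?sx ?sy ?minnn // -(nth_pad n x).
by rewrite nth_default ?sx ?mul0r.
Qed.

Lemma sum_take (s : seq R) r : (r <= size s)%N ->
  \sum_(a <- take r s) a = \sum_(j < r) s`_j.
Proof.
move=> rs; rewrite (big_nth 0) size_take_min (minn_idPl rs) big_mkord.
by apply: eq_bigr => j _; rewrite nth_take.
Qed.

(** The [r] largest entries of padded [x] sit at [r] positions. Those in the padding contribute
    nothing, which leaves at most [r] true indices, and the missing terms of [y] are
    non-negative. *)
Lemma wmaj_intro k (x y : seq R) : size x = k ->
  (forall i, y`_i.+1 <= y`_i) -> (forall i, 0 <= y`_i) ->
  (forall I : pred 'I_k, \sum_(i < k | I i) x`_i <= \sum_(j < #|I|) y`_j) ->
  wmaj x y.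
Proof.
move=> <- yS y0 h; rewrite /wmaj; set n := maxn _ _ => r rn.
have sx : size (pad n x) = n by rewrite size_pad ?leq_maxl.
have sy : size (pad n y) = n by rewrite size_pad ?leq_maxr.
have -> : sort_dec (pad n y) = pad n y.
  apply: sorted_sort; first by move=> a b c ab bc; apply: le_trans ab.
  by apply/(sortedP 0) => i _; rewrite !nth_pad.
rewrite (sum_take (s := pad n y)) ?sy //.
(* [Is] lists the positions in decreasing order of their entries. *)
have /(perm_iotaP 0)[Is pIs ->] : perm_eq (sort_dec (pad n x)) (pad n x).
  by rewrite perm_sort.
rewrite -map_take big_map; set I := take r Is.
have uI : uniq I by rewrite take_uniq // (perm_uniq pIs) iota_uniq.
have sI : (size I <= r)%N by rewrite size_take_min geq_minl.
pose J : pred 'I_(size x) := fun i => (i : nat) \in I.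
have -> : \sum_(i <- I) (pad n x)`_i = \sum_(i < size x | J i) x`_i.
  rewrite (bigID (fun i => (i < size x)%N)) /= [X in _ + X]big1 ?addr0; last first.
    by move=> i; rewrite -leqNgt => si; rewrite nth_pad nth_default.
  rewrite -big_filter.
  rewrite (perm_big [seq i <- iota 0 (size x) | i \in I]) /=; last first.
    apply: uniq_perm; rewrite ?filter_uniq ?iota_uniq // => i.
    by rewrite !mem_filter mem_iota add0n andbC.
  have -> : iota 0 (size x) = index_iota 0 (size x) by rewrite /index_iota subn0.
  rewrite big_filter big_mkord.
  by apply: eq_bigr => i _; rewrite nth_pad.
apply: le_trans (h J) _.
have JI : (#|J| <= r)%N.
  apply: leq_trans sI; rewrite cardE -(size_map val).
  apply: uniq_leq_size; first by rewrite map_inj_uniq ?enum_uniq //; exact: val_inj.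
  by move=> _ /mapP[i iJ ->]; move: iJ; rewrite mem_enum.
rewrite -(sum_ord_lt (fun j => y`_j) JI); apply: ler_sum => j _.
by rewrite nth_pad; case: (j < _)%N; rewrite ?mul1r ?mul0r.
Qed.

Lemma nth_absdiff (x y : seq R) i : size x = size y ->
  (i < size x)%N -> (absdiff x y)`_i = `|x`_i - y`_i|.
Proof.
move=> xy ix; rewrite (nth_map (0, 0)) ?size_zip -?xy ?minnn //.
by rewrite nth_zip.
Qed.

Section SpectralSpread.
Variables (d : nat) (A : 'M[C]_d).
Let lam := nth 0 (eigvals A).

Lemma size_spr_plus : size (spr_plus A) = d./2.
Proof. by rewrite size_map size_iota. Qed.

Lemma nth_spr_plus i : (i < d./2)%N ->
  (spr_plus A)`_i = lam i - lam (d - i.+1)%N.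
Proof. by move=> hi; rewrite (nth_map 0%N) ?size_iota // nth_iota. Qed.

Let lam_le i j : (i <= j)%N -> (j < d)%N -> lam j <= lam i.
Proof. by apply: noninc_le => l; apply: eigvals_sorted. Qed.

Lemma spr_plus_ge0 i : 0 <= (spr_plus A)`_i.
Proof.
case: (ltnP i d./2) => hi; last by rewrite nth_default ?size_spr_plus.
by rewrite nth_spr_plus // subr_ge0 lam_le //; lia.
Qed.

Lemma spr_plus_noninc i : (spr_plus A)`_i.+1 <= (spr_plus A)`_i.
Proof.
case: (ltnP i.+1 d./2) => hi; last by rewrite nth_default ?size_spr_plus ?spr_plus_ge0.
rewrite !nth_spr_plus //; last by lia.
by rewrite lerB // lam_le //; lia.
Qed.

(** Past [d./2] the spread is zero by default, so both lengths give the same sum. *)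
Lemma sum_spread_trunc (F : nat -> R) m :
  \sum_(j < d./2) F j * (j < m)%:R * (lam j - lam (d - j.+1)%N) =
  \sum_(j < m) F j * (spr_plus A)`_j.
Proof.
have -> : \sum_(j < d./2) F j * (j < m)%:R * (lam j - lam (d - j.+1)%N) =
    \sum_(j < d./2) (j < m)%:R * (F j * (spr_plus A)`_j).
  by apply: eq_bigr => j _; rewrite nth_spr_plus //; ring.
case: (leqP m d./2) => md; first by
  rewrite (sum_ord_lt (fun j => F j * (spr_plus A)`_j) md).
rewrite -(sum_ord_lt (fun j => F j * (spr_plus A)`_j) (leqnn m)).
rewrite (bigID (fun j : 'I_m => (j < d./2)%N)) /= [X in _ + X]big1 ?addr0.
  by rewrite -(big_ord_widen m (fun j => (j < m)%:R * (F j * (spr_plus A)`_j)) (ltnW md)).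
move=> j; rewrite -leqNgt => dj.
by rewrite [(spr_plus A)`_j]nth_default ?size_spr_plus // !mulr0.
Qed.

End SpectralSpread.

(** Shared by both claims, with [f] the identity or squaring; [f 0 = 0] makes mapping agree with
    padding. *)
Lemma ritz_wmaj d k (A : 'M[C]_d) (X Y : 'M[C]_(d, k)) (f : R -> R) :
  {in Num.nneg &, {homo f : a b / a <= b}} -> (forall a, 0 <= a -> 0 <= f a) -> f 0 = 0 ->
  (forall I : pred 'I_k,
    \sum_(i < k | I i) `|(eigvals (X^h *m A *m X))`_i - (eigvals (Y^h *m A *m Y))`_i| <=
    \sum_(j < d./2) f (angles X Y)`_j * (j < #|I|)%:R *
      ((eigvals A)`_j - (eigvals A)`_(d - j.+1))) ->
  X^h *m X = 1%:M -> Y^h *m Y = 1%:M ->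
  wmaj (absdiff (eigvals (X^h *m A *m X)) (eigvals (Y^h *m A *m Y)))
       (mulv [seq f t | t <- angles X Y] (spr_plus A)).
Proof.
move=> fmono f_ge0 f0 h Xi Yi; have [_ thS th0 _] := angles_spectral Xi Yi.
have nth_f i : [seq f t | t <- angles X Y]`_i = f (angles X Y)`_i.
  case: (ltnP i (size (angles X Y))) => hi; first by rewrite (nth_map 0).
  by rewrite !nth_default ?size_map.
have size_x : size (absdiff (eigvals (X^h *m A *m X)) (eigvals (Y^h *m A *m Y))) = k.
  by rewrite size_map size_zip !size_eigvals minnn.
apply: (wmaj_intro size_x) => [i|i|I].
- rewrite !nth_mulv !nth_f ler_pM ?spr_plus_ge0 ?spr_plus_noninc ?f_ge0 //.
  by apply: fmono; rewrite ?nnegrE.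
- by rewrite nth_mulv nth_f mulr_ge0 ?spr_plus_ge0 ?f_ge0.
rewrite (eq_bigr (fun i : 'I_k =>
    `|(eigvals (X^h *m A *m X))`_i - (eigvals (Y^h *m A *m Y))`_i|)); last first.
  by move=> i _; rewrite nth_absdiff ?size_eigvals.
apply: le_trans (h I) _.
rewrite (sum_spread_trunc A (fun j => f (angles X Y)`_j)).
by apply: ler_sum => j _; rewrite nth_mulv nth_f.
Qed.

End Concrete.

Theorem theorem3p3 (R : realType) (d k : nat) (A : 'M[R[i]]_d)
    (X Y : 'M[R[i]]_(d, k)) :
  is_hermitian A -> is_isometry X -> is_isometry Y ->
  wmaj (absdiff (eigvals (adjmx X *m A *m X)) (eigvals (adjmx Y *m A *m Y)))
       (mulv (angles X Y) (spr_plus A))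
  /\
  (A_invariant A X ->
   wmaj (absdiff (eigvals (adjmx X *m A *m X)) (eigvals (adjmx Y *m A *m Y)))
        (mulv (sqv (angles X Y)) (spr_plus A))).
Proof.
move=> /hermsymmxP Ah Xi Yi.
have [[U Uu ME] thS th0 sin_th] := angles_spectral Xi Yi.
have sandwich_h (S : 'M[R[i]]_(d, k)) : (S^h *m A *m S)^h = S^h *m A *m S.
  by rewrite !ctrM ctrK Ah mulmxA.
have [Ua Uau AE] := eigvals_spectral Ah (perm_refl _).
have [U1 U1u PE] := eigvals_spectral (sandwich_h X) (perm_refl _).
have [U2 U2u QE] := eigvals_spectral (sandwich_h Y) (perm_refl _).
have lamS := @eigvals_sorted _ _ A.
have pS := @eigvals_sorted _ _ (X^h *m A *m X).
have qS := @eigvals_sorted _ _ (Y^h *m A *m Y).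
split=> [|AX].
  rewrite -[angles X Y]map_id; apply: (ritz_wmaj (f := id)) => //.
  move=> I; exact: (ritz_bound Xi Yi Uau U1u U2u Uu lamS pS qS AE PE QE ME
    thS th0 sin_th I).
(* The row-space inclusion is transposed back into a factorization of [A *m X] through [X]. *)
have [B XB] : exists B, A *m X = X *m B.
  have /submxP[D hD] := AX; exists D^T.
  by rewrite -[LHS]trmxK trmx_mul hD trmx_mul trmxK.
apply: (ritz_wmaj (f := fun t => t ^+ 2)) => //.
- by move=> a b; rewrite !nnegrE => a0 b0 ab; rewrite lerXn2r ?nnegrE.
- by move=> a a0; apply: sqr_ge0.
- by rewrite expr0n.
move=> I; exact: (ritz_bound_invariant Xi Yi Uau U1u U2u Uu lamS pS qS AE PE QE ME
  thS th0 sin_th I XB).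
Qed.
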